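(* Let $n\ge5$. If $G$ is a connected graph of order $n$ with exactly $3$ pendant vertices such that $\rho_L(G)\ge\rho_L(G')$ for every connected graph $G'$ of order $n$ with exactly $3$ pendant vertices, then $G\cong T(n,3;1,2)$.
   Context: All graphs are simple and finite. For a connected graph $G$ with vertex set $\{v_1,\dots,v_n\}$, $d_G(u,v)$ is the distance, $Tr_G(u)=\sum_{v}d_G(u,v)$ is the transmission, $Tr(G)$ is the diagonal matrix of transmissions and $D(G)=(d_G(v_i,v_j))$ is the distance matrix. The distance Laplacian matrix is $L_D(G)=Tr(G)-D(G)$ and $\rho_L(G)$ is its largest eigenvalue. A pendant vertex is a vertex of degree $1$. $T(n,3;1,2)$ is the tree obtained from a path of order $n-3$ by attaching one pendant vertex to one end vertex of the path and two pendant vertices to the other end vertex. *)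

(* Defs.v *)
From HB Require Import structures.
From mathcomp Require Import all_boot all_order all_algebra.
From mathcomp Require Import classical_sets reals.

Set Implicit Arguments.
Unset Strict Implicit.
Unset Printing Implicit Defensive.

Import Order.TTheory GRing.Theory Num.Theory.
Local Open Scope ring_scope.

Record sgraph (V : finType) := SGraph {
  adj :> rel V;
  adj_sym : symmetric adj;
  adj_irr : irreflexive adj
}.

Section Generate.
Variables (V : finType) (e : rel V).

Definition gen_adj : rel V :=
  fun x y => (x != y) && (e x y || e y x).

Lemma gen_adj_sym : symmetric gen_adj.
Proof. by move=> x y; rewrite /gen_adj eq_sym orbC. Qed.

Lemma gen_adj_irr : irreflexive gen_adj.
Proof. by move=> x; rewrite /gen_adj eqxx. Qed.

Definition gen_graph : sgraph V := SGraph gen_adj_sym gen_adj_irr.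

End Generate.

Section Graph.
Variables (V : finType) (G : sgraph V).

Definition connected : Prop := forall u v : V, connect G u v.

Definition degree (v : V) : nat := #|[set w | G v w]|.

Definition pendants : {set V} := [set v | degree v == 1%N].

(* p lists the k vertices that follow u on a walk of length k *)
Definition has_walk (k : nat) (u v : V) : bool :=
  [exists p : k.-tuple V, path G u p && (last u p == v)].

(* The least length of a walk from u to v. Vertices in the same component are
   joined by a walk of length < #|V|; for the others the value is #|V|. *)
Definition dist (u v : V) : nat :=
  find (fun k => has_walk k u v) (iota 0 #|V|).

Definition transmission (u : V) : nat := (\sum_(v : V) dist u v)%N.

End Graph.

Definition isomorphic (V W : finType) (G : sgraph V) (H : sgraph W) : Prop :=
  exists2 f : V -> W, bijective f & forall u v : V, H (f u) (f v) = G u v.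

Section DistanceLaplacian.
Variables (R : realType) (n : nat) (G : sgraph 'I_n).

Definition distance_mx : 'M[R]_n := \matrix_(i, j) (dist G i j)%:R.

Definition transmission_mx : 'M[R]_n :=
  diag_mx (\row_i (transmission G i)%:R).

Definition distance_laplacian : 'M[R]_n := transmission_mx - distance_mx.

(* The matrix is real symmetric, so for n > 0 this set of real eigenvalues is
   finite and nonempty, and its supremum is its maximum. *)
Definition rho_L : R := sup [set a : R | eigenvalue distance_laplacian a]%classic.

End DistanceLaplacian.

(* T(n,3;1,2), for n >= 5: the path is 0 - 1 - ... - (n - 4), with n - 3
   pendant at 0, and n - 2 and n - 1 pendant at n - 4. *)
Definition T312_edge (n : nat) : rel 'I_n := fun i j : 'I_n =>
  ([|| (j == i.+1 :> nat) && (j <= n - 4),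
       (i == 0 :> nat) && (j == n - 3 :> nat)
     | (i == n - 4 :> nat) && ((j == n - 2 :> nat) || (j == n - 1 :> nat))])%N.

Definition T312 (n : nat) : sgraph 'I_n := gen_graph (@T312_edge n).

(* Main.v *)
(* For every connected graph with three pendant vertices, the distance function is
   dominated pointwise by a convex combination of the metrics of relabelled copies
   of T = T(n,3;1,2). Indeed, hang a vertex on the j-th vertex of a path: its
   distances to the path are convex in j, so its position can be replaced by a
   combination of the two ends of the path. Applied to the vertices one by one this
   turns the non-pendant part into a path, and applied to the three pendant vertices
   it turns the result into copies of T.

   The quadratic form of the distance Laplacian, the sum of d(u,v) (x_u - x_v)^2 over
   unordered pairs, is linear and monotone in d. Hence rho_L(G) <= rho_L(T), and in
   the case of equality a top eigenvector x of G is a top eigenvector of every copy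
   in the combination. A top eigenvector of T is strictly monotone along the longest
   path and takes the same value at the two leaves of the fork, so x determines the
   metric of the copy. Therefore only one copy occurs, and its metric agrees with
   that of G, except perhaps for the two leaves of the fork; as G has three pendant
   vertices, these are not adjacent. *)
Require Import Defs.
From mathcomp Require Import all_boot all_order all_algebra.
From mathcomp Require Import zify ring lra.

Set Implicit Arguments.
Unset Strict Implicit.
Unset Printing Implicit Defensive.

Import Order.TTheory GRing.Theory Num.Theory.

(** * Convex combinations of metrics *)

Section Hull.
Variable V : finType.
Implicit Types (A : {pred V}) (d : V -> V -> nat) (S : (V -> V -> nat) -> Prop).

(* The metrics dominated on [A] by a convex combination of metrics in [S], with
   denominators cleared. *)
Inductive hull A S : (V -> V -> nat) -> Prop :=
| hull_in d : S d -> hull A S d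
| hull_mix k1 k2 d1 d2 d : 0 < k1 + k2 -> hull A S d1 -> hull A S d2 ->
    {in A &, forall u v, (k1 + k2) * d u v <= k1 * d1 u v + k2 * d2 u v} ->
    hull A S d.

Lemma hull_le A S d d' : hull A S d' ->
  {in A &, forall u v, d u v <= d' u v} -> hull A S d.
Proof.
move=> hd' le_dd'; apply: (@hull_mix _ _ 1 0 d' d') => // u v Au Av.
by have := le_dd' u v Au Av; lia.
Qed.

(** [F] need not be linear: keeping every mixing inequality with the same weights is enough to push
    it through a derivation of [hull]. *)
Lemma hull_map A A' S S' F d :
    (forall d0, S d0 -> hull A' S' (F d0)) ->
    (forall k1 k2 d1 d2 d3, 0 < k1 + k2 ->
       {in A &, forall u v, (k1 + k2) * d3 u v <= k1 * d1 u v + k2 * d2 u v} ->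
       {in A' &, forall u v,
          (k1 + k2) * F d3 u v <= k1 * F d1 u v + k2 * F d2 u v}) ->
  hull A S d -> hull A' S' (F d).
Proof.
move=> FS Fmix; elim=> [d0 /FS //|k1 k2 d1 d2 d3 k_gt0 _ hd1 _ hd2 le_d].
exact: hull_mix k_gt0 hd1 hd2 (Fmix _ _ _ _ _ k_gt0 le_d).
Qed.

(** The metric after hanging [w] on another vertex [u] by an edge; the values of [d] at [w] are
    discarded. *)
Definition attach (w u : V) d : V -> V -> nat := fun a b =>
  if a == w then (if b == w then 0 else (d u b).+1)
  else if b == w then (d a u).+1 else d a b.

Lemma attach_mix A u w k1 k2 d1 d2 d3 : u \in A ->
    {in A &, forall a b, (k1 + k2) * d3 a b <= k1 * d1 a b + k2 * d2 a b} ->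
    {in [predU1 w & A] &, forall a b, (k1 + k2) * attach w u d3 a b
       <= k1 * attach w u d1 a b + k2 * attach w u d2 a b}.
Proof.
move=> Au le_d a b; rewrite !inE /attach.
case: (eqVneq a w) => [_ _|_ /= Aa]; case: (eqVneq b w) => [_ _|_ /= Ab].
- lia.
- by have := le_d _ _ Au Ab; nia.
- by have := le_d _ _ Aa Au; nia.
- exact: le_d.
Qed.

(* The metric of a caterpillar: [c] is the position along the spine and [h] the
   height above it. *)
Definition comb (T : eqType) (c h : T -> nat) : T -> T -> nat := fun u v =>
  if u == v then 0 else (c u - c v) + (c v - c u) + h u + h v.

Lemma absdiff_convex lo j hi b : lo <= j <= hi ->
  (hi - j + (j - lo)) * ((j - b) + (b - j)) <=
  (hi - j) * ((lo - b) + (b - lo)) + (j - lo) * ((hi - b) + (b - hi)).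
Proof.
move=> /andP[lo_j j_hi].
set P := _ + (b - j); set Q := _ + (b - lo); set S := _ + (b - hi).
have [x xE] : exists x, x = j - lo by exists (j - lo).
have [y yE] : exists y, y = hi - j by exists (hi - j).
(* For [b <= j] the bound [P <= Q + x] and the identity [S = P + y] suffice; the other side mirrors
   this. *)
rewrite -xE -yE; case: (leqP b j) => b_j.
  have : Q + x >= P by lia.
  have : S = P + y by lia.
  nia.
have : Q = P + x by lia.
have : S + y >= P by lia.
nia.
Qed.

Definition upd (c : V -> nat) w j : V -> nat := fun v => if v == w then j else c v.

(** Distances from [w] are absolute differences, hence convex in its position, and all other
    distances stay the same. The weights express [c w] through [lo] and [hi]. *)
Lemma comb_move A S c h w lo hi : lo < hi -> lo <= c w <= hi ->
  hull A S (comb (upd c w lo) h) -> hull A S (comb (upd c w hi) h) ->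
  hull A S (comb c h).
Proof.
move=> lo_hi c_w h_lo h_hi.
apply: (@hull_mix _ _ (hi - c w) (c w - lo) _ _ _ _ h_lo h_hi); first lia.
move=> u v _ _; rewrite /comb /upd; case: (eqVneq u v) => [_|uv]; first lia.
case: (eqVneq u w) => [uw|uw]; case: (eqVneq v w) => [vw|vw].
- by rewrite uw vw eqxx in uv.
- by subst u; have := absdiff_convex (c v) c_w; nia.
- by subst v; have := absdiff_convex (c u) c_w; nia.
- nia.
Qed.

End Hull.

(** * Moving leaves to the ends of a path *)

Section Labelings.
Variable V : finType.
Implicit Types (A : {pred V}) (d : V -> V -> nat) (c h g : V -> nat).

(** In use [A] has [m.+1] elements, so [g] numbers a path on all of [A] from 0 to [m]. *)
Definition path_metric A m d : Prop := exists g,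
  [/\ {in A &, injective g}, {in A, forall v, g v <= m} &
      {in A &, d =2 comb g (fun=> 0)}].

(** A leaf can be moved to either end of a path, where it merely lengthens the path by one
    vertex. *)
Lemma hull_path_attach A m u w d : u \in A -> w \notin A ->
  hull A (path_metric A m) d ->
  hull [predU1 w & A] (path_metric [predU1 w & A] m.+1) (attach w u d).
Proof.
move=> Au Aw; apply: hull_map; last by move=> *; exact: attach_mix.
move=> d0 [g [g_inj g_le d0E]]; set A' := [predU1 w & A].
have wA v : v \in A -> v != w by apply: contraTneq => ->.
set c := fun v => if v == w then g u else g v.
set h := fun v => (v == w) : nat.
have cw : c w = g u by rewrite /c eqxx.
have gu := g_le _ Au.
have hlo : hull A' (path_metric A' m.+1) (comb (upd c w 0) h).
  apply: hull_in; exists (fun v => if v == w then 0 else (g v).+1); split.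
  - move=> a b; rewrite !inE.
    case: (eqVneq a w) => [->|_]; case: (eqVneq b w) => [->|_] //=.
    by move=> Aa Ab [] /(g_inj _ _ Aa Ab).
  - move=> a; rewrite !inE; case: (eqVneq a w) => [->|_] //= /g_le; lia.
  - move=> a b; rewrite !inE /comb /upd /c /h; case: (eqVneq a b) => // ab.
    case: (eqVneq a w) ab => [->|_]; case: (eqVneq b w) => [->|_];
      rewrite ?eqxx //=; lia.
have hhi : hull A' (path_metric A' m.+1) (comb (upd c w m) h).
  apply: hull_in; exists (fun v => if v == w then m.+1 else g v); split.
  - move=> a b; rewrite !inE.
    case: (eqVneq a w) => [->|_]; case: (eqVneq b w) => [->|_] //=.
    + by move=> _ /g_le; lia.
    + by move=> /g_le; lia.
    + exact: g_inj.
  - by move=> a; rewrite !inE; case: (eqVneq a w) => [->|_] //= /g_le; lia.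
  - move=> a b; rewrite !inE /comb /upd /c /h; case: (eqVneq a b) => // ab.
    case: (eqVneq a w) ab => [->|_]; case: (eqVneq b w) => [->|_];
      rewrite ?eqxx //= => ab Aa Ab; try (have := g_le _ Aa); try (have := g_le _ Ab); lia.
have hc : hull A' (path_metric A' m.+1) (comb c h).
  (* [comb_move] needs distinct ends, which fails for [m = 0]. If [c w = 0], the copy with [w] at
     the lower end is already the metric itself. *)
  have [cw0|cw_gt0] := posnP (c w); last by apply: comb_move hlo hhi; lia.
  apply: hull_le hlo _ => a b _ _; rewrite /comb /upd.
  have [/eqP ab|ab] := boolP (a == b); first by [].
  by case: (eqVneq a w) => [aw|_]; case: (eqVneq b w) => [bw|_]; subst => //; lia.
apply: hull_le hc _ => a b; rewrite !inE /attach /comb /c /h.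
case: (eqVneq a w) => [->|aw] /=; case: (eqVneq b w) => [->|bw] //= Aa Ab.
- by rewrite d0E // /comb; case: (eqVneq u b) => [->|_]; lia.
- by rewrite d0E // /comb (negPf aw); case: (eqVneq a u) => [->|_]; lia.
- by rewrite d0E.
Qed.

(* The tree $T(n,3;1,2)$ with its longest path numbered 0, ..., n - 2; the
   vertex n - 1 hangs on n - 3. *)
Definition tail_pos n i := if i == n.-1 then n - 3 else i.
Definition tail_height n i : nat := (i == n.-1).
Definition tail_comb n g := comb (tail_pos n \o g) (tail_height n \o g).
Definition tail_metric n d : Prop := exists g,
  [/\ injective g, forall v, g v < n & d =2 tail_comb n g].

Section Three.
Variable m : nat.
Hypothesis m_gt0 : 0 < m.

Lemma three_cases (w1 w2 w3 v : V) :
  [\/ v = w1, v = w2, v = w3 | [/\ v != w1, v != w2 & v != w3]].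
Proof.
case: (eqVneq v w1) => [->|]; first by constructor 1.
case: (eqVneq v w2) => [->|]; first by constructor 2.
case: (eqVneq v w3) => [->|]; first by constructor 3.
by constructor 4.
Qed.

(* The vertices other than the [w]s form a path numbered by [g]; the [w]s hang
   on its vertices [j1], [j2] and [j3]. *)
Definition tripod (w1 w2 w3 : V) j1 j2 j3 g c h : Prop :=
  [/\ forall v, v != w1 -> v != w2 -> v != w3 -> [/\ c v = g v, h v = 0 & g v <= m],
      forall u v, u != w1 -> u != w2 -> u != w3 ->
        v != w1 -> v != w2 -> v != w3 -> g u = g v -> u = v,
      [/\ w1 != w2, w1 != w3 & w2 != w3],
      [/\ c w1 = j1, c w2 = j2 & c w3 = j3] &
      [/\ h w1 = 1, h w2 = 1 & h w3 = 1]].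

(** With this symmetry it is enough to move the first leg. *)
Lemma tripod_rotate w1 w2 w3 j1 j2 j3 g c h :
  tripod w1 w2 w3 j1 j2 j3 g c h -> tripod w2 w3 w1 j2 j3 j1 g c h.
Proof.
case=> H1 H2 [n12 n13 n23] [c1 c2 c3] [h1 h2 h3].
by split; rewrite ?[_ == w1]eq_sym; auto.
Qed.

Lemma tripod_rev w1 w2 w3 j1 j2 j3 g c h : tripod w1 w2 w3 j1 j2 j3 g c h ->
  tripod w1 w2 w3 (m - j1) (m - j2) (m - j3) (fun v => m - g v) (fun v => m - c v) h.
Proof.
case=> H1 H2 [n12 n13 n23] [c1 c2 c3] [h1 h2 h3].
split=> //.
- by move=> v v1 v2 v3; have [-> -> _] := H1 v v1 v2 v3; split=> //; lia.
- move=> u v u1 u2 u3 v1 v2 v3; have [_ _ gu] := H1 u u1 u2 u3.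
  by have [_ _ gv] := H1 v v1 v2 v3 => guv; apply: H2 => //; lia.
- by rewrite c1 c2 c3.
Qed.

Lemma tripod_le w1 w2 w3 j1 j2 j3 g c h v : tripod w1 w2 w3 j1 j2 j3 g c h ->
  j1 <= m -> j2 <= m -> j3 <= m -> c v <= m.
Proof.
case=> H1 _ _ [c1 c2 c3] _ *.
by have [->|->|->|[v1 v2 v3]] := three_cases w1 w2 w3 v; rewrite ?c1 ?c2 ?c3 //;
  have [-> _ ->] := H1 v v1 v2 v3.
Qed.

Lemma comb_rev w1 w2 w3 j1 j2 j3 g c h : tripod w1 w2 w3 j1 j2 j3 g c h ->
  j1 <= m -> j2 <= m -> j3 <= m -> comb c h =2 comb (fun v => m - c v) h.
Proof.
move=> T l1 l2 l3 u v; rewrite /comb; case: (eqVneq u v) => // _.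
by have := tripod_le u T l1 l2 l3; have := tripod_le v T l1 l2 l3; lia.
Qed.

Lemma tail_metric_ext d d' : d =2 d' -> tail_metric m.+4 d -> tail_metric m.+4 d'.
Proof. by move=> dd' [g [g1 g2 g3]]; exists g; split=> // u v; rewrite -dd' g3. Qed.

Lemma tripod_tail w1 w2 w3 g c h :
  tripod w1 w2 w3 0 m m g c h -> tail_metric m.+4 (comb c h).
Proof.
case=> H1 H2 [n12 n13 n23] [c1 c2 c3] [h1 h2 h3].
(* [w1] starts the longest path and [w2] ends it; [w3] gets the last number, that of the additional
   leaf. *)
pose f v := if v == w1 then 0 else if v == w2 then m.+2
  else if v == w3 then m.+3 else (g v).+1.
have f1 : f w1 = 0 by rewrite /f eqxx.
have f2 : f w2 = m.+2 by rewrite /f eq_sym (negPf n12) eqxx.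
have f3 : f w3 = m.+3.
  by rewrite /f eq_sym (negPf n13) [w3 == w2]eq_sym (negPf n23) eqxx.
have f4 v : v != w1 -> v != w2 -> v != w3 -> f v = (g v).+1.
  by rewrite /f => /negPf-> /negPf-> /negPf->.
exists f; split.
- move=> u v; have [->|->|->|[u1 u2 u3]] := three_cases w1 w2 w3 u;
    have [->|->|->|[v1 v2 v3]] := three_cases w1 w2 w3 v => //; rewrite ?f1 ?f2 ?f3;
    rewrite ?(f4 _ u1 u2 u3) ?(f4 _ v1 v2 v3);
    try (have [_ _] := H1 _ u1 u2 u3); try (have [_ _] := H1 _ v1 v2 v3); try lia.
  by move=> _ _ [] /H2; exact.
- move=> v; have [->|->|->|[v1 v2 v3]] := three_cases w1 w2 w3 v;
    rewrite ?f1 ?f2 ?f3 //.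
  by rewrite (f4 _ v1 v2 v3); have [_ _] := H1 _ v1 v2 v3; lia.
pose p v := tail_pos m.+4 (f v); pose t v := tail_height m.+4 (f v).
have [p1 p2 p3] : [/\ p w1 = 0, p w2 = m.+2 & p w3 = m.+1].
  by rewrite /p /tail_pos f1 f2 f3 /= eqxx; split=> //; case: eqP => //; lia.
have [t1 t2 t3] : [/\ t w1 = 0, t w2 = 0 & t w3 = 1].
  by rewrite /t /tail_height f1 f2 f3 /=; split; lia.
have pt4 v : v != w1 -> v != w2 -> v != w3 -> p v = (g v).+1 /\ t v = 0.
  move=> v1 v2 v3; have [_ _ gv] := H1 v v1 v2 v3.
  by rewrite /p /t /tail_pos /tail_height (f4 _ v1 v2 v3) /=; case: eqP; lia.
move=> u v; rewrite /tail_comb /comb; case: (eqVneq u v) => // uv /=.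
rewrite -/(p u) -/(p v) -/(t u) -/(t v).
have [uE|uE|uE|[u1 u2 u3]] := three_cases w1 w2 w3 u;
  have [vE|vE|vE|[v1 v2 v3]] := three_cases w1 w2 w3 v; subst; rewrite ?eqxx // in uv *;
  rewrite ?p1 ?p2 ?p3 ?t1 ?t2 ?t3 ?c1 ?c2 ?c3 ?h1 ?h2 ?h3;
  try (have [-> ->] := pt4 _ u1 u2 u3); try (have [-> ->] := pt4 _ v1 v2 v3);
  try (have [-> -> ?] := H1 _ u1 u2 u3); try (have [-> -> ?] := H1 _ v1 v2 v3); lia.
Qed.

Let full d := hull predT (tail_metric m.+4) d.

Lemma tripod_tail_rev w1 w2 w3 g c h :
  tripod w1 w2 w3 m 0 0 g c h -> tail_metric m.+4 (comb c h).
Proof.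
move=> T; have := tripod_rev T; rewrite subnn subn0 => /tripod_tail.
by apply: tail_metric_ext => u v; rewrite -(comb_rev T).
Qed.

(** A leaf hanging on position 0 can be viewed as a new first spine vertex, all other positions
    growing by one. *)
Lemma comb_shift w c h c' h' : c w = 0 -> h w = 1 -> c' w = 0 -> h' w = 0 ->
  (forall v, v != w -> c' v = (c v).+1 /\ h' v = h v) -> comb c h =2 comb c' h'.
Proof.
move=> cw hw c'w h'w H u v; rewrite /comb; have [//|uv] := eqVneq u v.
have [uw|/H[-> ->]] := eqVneq u w; have [vw|/H[-> ->]] := eqVneq v w; subst; try lia.
by rewrite eqxx in uv.
Qed.

(** The leaf [w] takes the number [m.+3], which [tail_pos] sends to [m.+1], the last position but
    one of the path. *)
Lemma tail_of_path w c h : {in predC1 w &, injective c} ->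
  {in predC1 w, forall v, c v <= m.+2 /\ h v = 0} -> c w = m.+1 -> h w = 1 ->
  tail_metric m.+4 (comb c h).
Proof.
move=> c_inj c_le cw hw; exists (fun v => if v == w then m.+3 else c v).
have c_le' v : v != w -> c v <= m.+2 by move=> /c_le[].
have h0 v : v != w -> h v = 0 by move=> /c_le[].
split.
- move=> u v; have [->|uw] := eqVneq u w; have [->|vw] := eqVneq v w => //.
  + by have := c_le' _ vw; lia.
  + by have := c_le' _ uw; lia.
  + exact: c_inj.
- by move=> v; have [//|vw] := eqVneq v w; have := c_le' _ vw; lia.
have tE v : tail_pos m.+4 (if v == w then m.+3 else c v) = c v /\
    tail_height m.+4 (if v == w then m.+3 else c v) = h v.
  rewrite /tail_pos /tail_height; have [vw|vw] := eqVneq v w.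
    by rewrite vw /= eqxx hw cw; lia.
  by have := c_le' _ vw; rewrite (h0 _ vw); case: eqP => /=; lia.
by move=> u v; rewrite /tail_comb /comb /=; have [-> ->] := tE u; have [-> ->] := tE v.
Qed.

(* All three pendant vertices on vertex 0: regard [w2] as the first vertex of the
   path and move [w1] along it. If [w1] ends up on [w2], regard it as the first
   vertex and move [w3] between the second vertex and the last but one. *)
Lemma tripod_head w1 w2 w3 g c h : tripod w1 w2 w3 0 0 0 g c h -> full (comb c h).
Proof.
case=> H1 H2 [n12 n13 n23] [c1 c2 c3] [h1 h2 h3].
have n21 : w2 != w1 by rewrite eq_sym.
have n31 : w3 != w1 by rewrite eq_sym.
have n32 : w3 != w2 by rewrite eq_sym.
pose c' v := if v == w2 then 0 else (c v).+1.
pose h' v := if v == w2 then 0 else h v.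
have c'2 : c' w2 = 0 by rewrite /c' eqxx.
have h'2 : h' w2 = 0 by rewrite /h' eqxx.
have c'N v : v != w2 -> c' v = (c v).+1 by rewrite /c' => /negPf->.
have h'N v : v != w2 -> h' v = h v by rewrite /h' => /negPf->.
have cc' : comb c h =2 comb c' h'.
  by apply: (@comb_shift w2) => // v vw; rewrite c'N ?h'N.
suff hc' : full (comb c' h') by apply: hull_le hc' _ => u v _ _; rewrite cc'.
(* Position [m.+1] in the new numbering is [m] in the old one. With [w2] a leaf again, this end is
   the tripod with legs at [m], 0 and 0, which is the extremal tree. *)
apply: (@comb_move _ _ _ _ _ w1 0 m.+1); rewrite ?c'N ?c1 //; last first.
  apply/hull_in/(tail_metric_ext _ (@tripod_tail_rev w1 w2 w3 g (upd c w1 m) h _)).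
    apply: (@comb_shift w2) => //; rewrite /upd ?(negPf n21) // => v vw.
    by rewrite h'N // c'N //; case: eqP.
  split=> //; last by rewrite /upd eqxx (negPf n21) (negPf n31).
  by move=> v v1 v2 v3; rewrite /upd (negPf v1); exact: H1.
(* At the other end [w1] hangs on [w2] and becomes vertex 0, so that [w3] now hangs on position
   2. *)
pose c'' v := if v == w1 then 0 else (c' v).+1.
pose h'' v : nat := v == w3.
have c''1 : c'' w1 = 0 by rewrite /c'' eqxx.
have c''N v : v != w1 -> c'' v = (c' v).+1 by rewrite /c'' => /negPf->.
have c''2 : c'' w2 = 1 by rewrite c''N // c'2.
have c''3 : c'' w3 = 2 by rewrite c''N // c'N // c3.
have c''P v : v != w1 -> v != w2 -> v != w3 -> c'' v = (g v).+2 /\ g v <= m.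
  by move=> v1 v2 v3; rewrite c''N // c'N //; have [-> _ ->] := H1 v v1 v2 v3.
have cc'' : comb (upd c' w1 0) h' =2 comb c'' h''.
  apply: (@comb_shift w1); rewrite /upd ?eqxx //.
  - by rewrite h'N.
  - by rewrite /h'' (negPf n13).
  move=> v v1; rewrite (negPf v1) c''N //; split=> //.
  rewrite /h' /h''; have [->|v2] := eqVneq v w2; first by rewrite (negPf n23).
  have [->|v3] := eqVneq v w3; first by rewrite h3.
  by have [_ -> _] := H1 v v1 v2 v3.
suff hc'' : full (comb c'' h'') by apply: hull_le hc'' _ => u v _ _; rewrite cc''.
have c''_le : {in predC1 w3, forall v, c'' v <= m.+2 /\ h'' v = 0}.
  move=> v; rewrite inE => v3; rewrite /h'' (negPf v3).
  have [->|v1] := eqVneq v w1; first by rewrite c''1.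
  have [->|v2] := eqVneq v w2; first by rewrite c''2.
  by have [-> ?] := c''P v v1 v2 v3.
have c''_inj : {in predC1 w3 &, injective c''}.
  move=> u v; rewrite !inE => u3 v3.
  have [uE|uE|uE|[u1 u2 _]] := three_cases w1 w2 w3 u;
    have [vE|vE|vE|[v1 v2 _]] := three_cases w1 w2 w3 v; subst;
    rewrite ?eqxx // in u3 v3 *; rewrite ?c''1 ?c''2 //.
  all: try (have [-> _] := c''P _ u1 u2 u3); try (have [-> _] := c''P _ v1 v2 v3).
  all: try by [].
  by move=> [] /H2; exact.
have h''3 : h'' w3 = 1 by rewrite /h'' eqxx.
apply: (@comb_move _ _ _ _ _ w3 1 m.+1); rewrite ?c''3 //; last first.
  apply/hull_in/(@tail_of_path w3) => //; last by rewrite /upd eqxx.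
    by move=> u v uw vw; rewrite /upd (negPf uw) (negPf vw); exact: c''_inj.
  by move=> v vw; rewrite /upd (negPf vw); exact: c''_le.
have upd_le v : upd c'' w3 1 v <= m.+2.
  by rewrite /upd; have [//|vw] := eqVneq v w3; have [] := c''_le v vw.
(* Reversing the path turns position 1 into [m.+1], as [tail_of_path] requires. *)
pose cr v := m.+2 - upd c'' w3 1 v.
apply/hull_in/(tail_metric_ext _ (@tail_of_path w3 cr h'' _ _ _ _)); rewrite /cr.
- move=> u v; rewrite /comb; case: (eqVneq u v) => // _.
  by have := upd_le u; have := upd_le v; lia.
- move=> u v uw vw; have := upd_le u; have := upd_le v.
  rewrite /upd (negPf uw) (negPf vw) => lv lu e.
  by apply: c''_inj => //; lia.
- by move=> v vw; rewrite leq_subr; have [_ ->] := c''_le v vw.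
- by rewrite /upd eqxx subn1.
- by [].
Qed.

Lemma tripod_head_rev w1 w2 w3 g c h : tripod w1 w2 w3 m m m g c h -> full (comb c h).
Proof.
move=> T; have := tripod_rev T; rewrite subnn => /tripod_head hT.
by apply: hull_le hT _ => u v _ _; rewrite -(comb_rev T).
Qed.

Lemma tripod_upd1 w1 w2 w3 j1 j2 j3 j g c h : tripod w1 w2 w3 j1 j2 j3 g c h ->
  tripod w1 w2 w3 j j2 j3 g (upd c w1 j) h.
Proof.
case=> H1 H2 [n12 n13 n23] [c1 c2 c3] [h1 h2 h3].
split=> //.
- by move=> v v1 v2 v3; rewrite /upd (negPf v1); exact: H1.
- by rewrite /upd eqxx ![_ == w1]eq_sym (negPf n12) (negPf n13).
Qed.

Lemma tripod_hull w1 w2 w3 j1 j2 j3 g c h : j1 <= m -> j2 <= m -> j3 <= m ->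
  tripod w1 w2 w3 j1 j2 j3 g c h -> full (comb c h).
Proof.
(* Each leg in turn is split between the two ends and rotated away. After three rounds the original
   order is back, and the eight placements have either two legs at one end and one at the other, or
   all legs at the same end. *)
have ends w1' w2' w3' j1' j2' j3' c' : j1' <= m ->
    (forall j c'', j = 0 \/ j = m ->
       tripod w1' w2' w3' j j2' j3' g c'' h -> full (comb c'' h)) ->
    tripod w1' w2' w3' j1' j2' j3' g c' h -> full (comb c' h).
  move=> l1 H T; have [_ _ _ [c1 _ _] _] := T.
  apply: (@comb_move _ _ _ _ _ w1' 0 m) => //; first by rewrite c1.
    by apply: (H 0); [left|exact: tripod_upd1 T].
  by apply: (H m); [right|exact: tripod_upd1 T].
move=> l1 l2 l3; apply: (ends) => // {l1}j1 {}c e1 /tripod_rotate.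
apply: (ends) => // {l2}j2 {}c e2 /tripod_rotate.
apply: (ends) => // {l3}j3 {}c e3 /tripod_rotate.
case: e1 => ->; case: e2 => ->; case: e3 => ->.
- exact: tripod_head.
- by move=> /tripod_rotate/tripod_rotate/tripod_tail_rev; exact: hull_in.
- by move=> /tripod_rotate/tripod_tail_rev; exact: hull_in.
- by move=> /tripod_tail; exact: hull_in.
- by move=> /tripod_tail_rev; exact: hull_in.
- by move=> /tripod_rotate/tripod_tail; exact: hull_in.
- by move=> /tripod_rotate/tripod_rotate/tripod_tail; exact: hull_in.
- exact: tripod_head_rev.
Qed.

End Three.
End Labelings.

(** * Graph distances *)

Section Distance.
Variables (V : finType) (G : sgraph V).

Lemma has_walk0 u v : has_walk G 0 u v = (u == v).
Proof.
by apply/existsP/idP => [[p]|uv]; [rewrite tuple0|exists [tuple]].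
Qed.

Lemma has_walkS k u v : has_walk G k.+1 u v = [exists w, G u w && has_walk G k w v].
Proof.
apply/existsP/existsP => [[p]|[w /andP[uw /existsP[p /andP[pp pl]]]]].
  case/tupleP: p => w p /= /andP[/andP[uw pp] pl].
  by exists w; rewrite uw; apply/existsP; exists p; rewrite pp.
by exists [tuple of w :: p]; rewrite /= uw pp.
Qed.

Lemma has_walk_rcons k u v w : has_walk G k u w -> G w v -> has_walk G k.+1 u v.
Proof.
case/existsP => p /andP[pp /eqP pl] wv; apply/existsP; exists [tuple of rcons p v].
by rewrite /= rcons_path pp pl wv last_rcons /=.
Qed.

Lemma dist_le k u v : has_walk G k u v -> dist G u v <= k.
Proof.
move=> walk; rewrite leqNgt; apply/negP => k_lt.
have := before_find 0 k_lt; rewrite nth_iota ?add0n ?walk //.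
by apply: leq_trans k_lt _; rewrite -[leqRHS](size_iota 0); exact: find_size.
Qed.

Lemma distvv u : dist G u u = 0.
Proof. by apply/eqP; rewrite -leqn0 dist_le // has_walk0. Qed.

Section Connected.
Hypothesis G_conn : connected G.

(** A path without repetitions is shorter than [#|V|], so the search defining [dist] succeeds. *)
Lemma has_walk_dist u v : has_walk G (dist G u v) u v.
Proof.
have /connectP[p0 path_p0 ->] := G_conn u v.
case/shortenP: path_p0 => p path_p uniq_p _.
set P := fun k => has_walk G k u (last u p).
have lt_p : size p < #|V| by have := card_uniqP uniq_p => /= <-; exact: max_card.
have hasP : has P (iota 0 #|V|).
  apply/hasP; exists (size p); first by rewrite mem_iota.
  by apply/existsP; exists (in_tuple p); rewrite path_p eqxx.
have := nth_find 0 hasP; rewrite nth_iota //.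
by rewrite -[ltnRHS](size_iota 0) -has_find.
Qed.

Lemma dist_eq0 u v : (dist G u v == 0) = (u == v).
Proof.
apply/eqP/eqP => [d0|->]; last exact: distvv.
by apply/eqP; rewrite -has_walk0 -d0; exact: has_walk_dist.
Qed.

Lemma dist_adj u w v : G u w -> dist G u v <= (dist G w v).+1.
Proof.
move=> uw; apply: dist_le; rewrite has_walkS; apply/existsP; exists w.
by rewrite uw has_walk_dist.
Qed.

Lemma dist_sym u v : dist G u v = dist G v u.
Proof.
suff le_dist a b : dist G a b <= dist G b a by apply/eqP; rewrite eqn_leq !le_dist.
move: (has_walk_dist b a); move: (dist G b a) => k; elim: k b => [|k IHk] b.
  by rewrite has_walk0 => /eqP->; rewrite distvv.
rewrite has_walkS => /existsP[w /andP[bw /IHk le_k]].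
apply: leq_trans (_ : (dist G a w).+1 <= _) => //; apply: dist_le.
by apply: has_walk_rcons (has_walk_dist a w) _; rewrite adj_sym.
Qed.

Lemma dist_eq1 u v : (dist G u v == 1) = G u v.
Proof.
apply/eqP/idP => [d1|uv].
  move: (has_walk_dist u v); rewrite d1 has_walkS => /existsP[w /andP[uw]].
  by rewrite has_walk0 => /eqP<-.
apply/eqP; rewrite eqn_leq lt0n dist_eq0; apply/andP; split.
  by have := dist_adj v uv; rewrite distvv.
by apply: contraTneq uv => ->; rewrite adj_irr.
Qed.

End Connected.

(** The second condition bounds [d] by the length of every walk; the third builds a walk of length
    [d u v], which also yields connectedness. *)
Lemma dist_unique (d : V -> V -> nat) : (forall u, d u u = 0) ->
    (forall u w v, G u w -> d u v <= (d w v).+1) ->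
    (forall u v, u != v -> exists2 w, G u w & d u v = (d w v).+1) ->
  connected G /\ dist G =2 d.
Proof.
move=> d0 d_adj d_step.
have walk_le k u v : has_walk G k u v -> d u v <= k.
  elim: k u => [|k IHk] u; first by rewrite has_walk0 => /eqP->; rewrite d0.
  rewrite has_walkS => /existsP[w /andP[uw /IHk]].
  by have := d_adj u w v uw; lia.
have le_walk k u v : d u v = k -> has_walk G k u v /\ connect G u v.
  elim: k u => [|k IHk] u duv.
    have [->|/d_step[w _]] := eqVneq u v; last by rewrite duv.
    by rewrite has_walk0 eqxx.
  have [uv|/d_step[w uw dw]] := eqVneq u v; first by rewrite uv d0 in duv.
  have [|walk_w conn_w] := IHk w; first by lia.
  split; last exact: connect_trans (connect1 uw) conn_w.
  by rewrite has_walkS; apply/existsP; exists w; rewrite uw.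
have conn : connected G by move=> u v; exact: (le_walk _ u v erefl).2.
split=> // u v; apply/eqP; rewrite eqn_leq dist_le; last exact: (le_walk _ u v erefl).1.
exact: walk_le (has_walk_dist conn u v).
Qed.

Lemma pendant_adj w x y : w \in pendants G -> G w x -> G w y -> x = y.
Proof.
rewrite inE /degree => /cards1P[z zE] wx wy.
have : x \in [set z] by rewrite -zE inE.
have : y \in [set z] by rewrite -zE inE.
by rewrite !inE => /eqP-> /eqP->.
Qed.

(* With its pendant neighbours [A] is closed under adjacency. *)
Lemma pendant_closure (A : {set V}) : connected G -> A != set0 ->
    [disjoint A & pendants G] ->
    (forall a x, a \in A -> x \notin pendants G -> G a x -> x \in A) ->
  A = ~: pendants G /\ forall w, w \in pendants G -> exists2 a, a \in A & G w a.
Proof.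
move=> G_conn /set0Pn[a0 Aa0] disjA A_closed.
pose B := [pred v | (v \in A) || (v \in pendants G) && [exists a in A, G v a]].
have B_closed : closed G B.
  apply: intro_closed => [|x y xy].
    exact: (sym_connect_sym (@adj_sym _ G)).
  rewrite [in X in X -> _]inE => /orP[Ax|/andP[Wx /exists_inP[a Aa xa]]].
    rewrite inE; have [Wy|Wy] := boolP (y \in pendants G).
      by apply/orP; right; apply/exists_inP; exists x; rewrite // adj_sym.
    by rewrite (A_closed x).
  by rewrite inE (pendant_adj Wx xy xa) Aa.
have B_all v : v \in B.
  by rewrite -(closed_connect B_closed (G_conn a0 v)) inE Aa0.
split.
  apply/setP => v; rewrite [RHS]inE; apply/idP/idP => [Av|Wv].
    by rewrite (disjointFr disjA Av).
  by have := B_all v; rewrite inE (negPf Wv) orbF.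
move=> w Ww; have := B_all w; rewrite inE (disjointFl disjA Ww) Ww.
by case/exists_inP => a; exists a.
Qed.

(** This is the triangle inequality through [u]. Equality may fail, because [w] can have neighbours
    besides [u]. *)
Lemma le_attach (w u : V) d d' : d =2 (fun x y => d y x) -> d w w = 0 ->
  (forall v, d w v <= (d u v).+1) -> (forall x y, d x y <= d' x y) ->
  forall x y, d x y <= attach w u d' x y.
Proof.
move=> d_sym dw0 d_adj le_dd' x y; rewrite /attach.
case: (eqVneq x w) => [->|_]; case: (eqVneq y w) => [->|_].
- by rewrite dw0.
- by apply: leq_trans (d_adj y) _; rewrite ltnS.
- by rewrite d_sym; apply: leq_trans (d_adj x) _; rewrite ltnS d_sym.
- exact: le_dd'.
Qed.

Lemma attach_comb (A : {pred V}) w u d c h : u \in A -> c w = c u -> h w = (h u).+1 ->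
    {in A &, forall a b, d a b <= comb c h a b} ->
  {in [predU1 w & A] &, forall a b, attach w u d a b <= comb c h a b}.
Proof.
move=> Au cw hw le_d a b; rewrite !inE /attach.
have [->|aw] /= := eqVneq a w; have [->|bw] //= := eqVneq b w => Aa Ab.
- have := le_d _ _ Au Ab; rewrite /comb [w == b]eq_sym (negPf bw).
  by case: (eqVneq u b) => [<-|_]; lia.
- have := le_d _ _ Aa Au; rewrite /comb (negPf aw).
  by case: (eqVneq a u) => [->|_]; lia.
- exact: le_d.
Qed.

Lemma dist_hull m : connected G -> #|pendants G| = 3 -> #|V| = m.+4 -> 0 < m ->
  hull predT (tail_metric m.+4) (dist G).
Proof.
move=> G_conn W3 cardV m_gt0; set W := pendants G in W3 *.
have U_card : #|~: W| = m.+1 by have := cardsC W; rewrite W3 cardV; lia.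
(* [A] grows inside the non-pendant vertices; each new vertex is hung on one neighbour, and
   [hull_path_attach] straightens the result into a path. *)
have grow k : k <= m -> exists A : {set V},
    [/\ A \subset ~: W, #|A| = k.+1 &
        hull (mem A) (path_metric (mem A) k) (dist G)].
  elim: k => [|k IHk] k_le.
    have /set0Pn[v Uv] : ~: W != set0 by rewrite -card_gt0 U_card.
    exists [set v]; split; [by rewrite sub1set|by rewrite cards1|].
    apply: hull_in; exists (fun=> 0); split=> //.
      by move=> a b; rewrite !inE => /eqP-> /eqP->.
    by move=> a b; rewrite !inE => /eqP-> /eqP->; rewrite distvv /comb eqxx.
  have [A [AU A_card A_hull]] := IHk (ltnW k_le).
  have A_neq0 : A != set0 by rewrite -card_gt0 A_card.
  have disjA : [disjoint A & W] by rewrite -[W]setCK -subsets_disjoint.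
  (* Without such an edge [pendant_closure] would make [A] the set of all non-pendant vertices,
     against its cardinality. *)
  have : [exists a in A, exists x in ~: W :\: A, G a x].
    apply: contraT => /exists_inPn no_edge; exfalso.
    have [|AE _] := pendant_closure G_conn A_neq0 disjA.
      move=> a x Aa Wx ax; apply: contraT => Ax; case/negP: (no_edge a Aa).
      by apply/exists_inP; exists x => //; rewrite in_setD in_setC Ax.
    by move: A_card; rewrite AE U_card; lia.
  case/exists_inP => u Au /exists_inP[w]; rewrite in_setD in_setC => /andP[wA wW] uw.
  exists (w |: A); split.
  - by rewrite subUset AU sub1set in_setC wW.
  - by rewrite cardsU1 wA A_card.
  have := hull_path_attach Au wA A_hull.
  have AE v : v \in w |: A -> v \in [predU1 w & mem A] by rewrite !inE.
  move=> h_att; apply: (@hull_le _ _ _ _ (attach w u (dist G))).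
    apply: (@hull_map _ _ _ _ _ id) h_att => [d0 [g [g1 g2 g3]]|]; last first.
      by move=> k1 k2 d1 d2 d3 _ le_d a b /AE Aa /AE Ab; exact: le_d.
    apply: hull_in; exists g; split=> [a b /AE Aa /AE Ab|a /AE Aa|a b /AE Aa /AE Ab].
    - exact: g1.
    - exact: g2.
    - exact: g3.
  move=> a b _ _; apply: le_attach => //; first by move=> *; exact: dist_sym.
    exact: distvv.
  by move=> v; apply: dist_adj => //; rewrite adj_sym.
have [A [AU A_card A_hull]] := grow m (leqnn m).
have AE : A = ~: W by apply/eqP; rewrite eqEcard AU A_card U_card leqnn.
have A_neq0 : A != set0 by rewrite -card_gt0 A_card.
have disjA : [disjoint A & W] by rewrite -[W]setCK -subsets_disjoint.
have [|_ W_adj] := pendant_closure G_conn A_neq0 disjA.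
  by move=> a x _ Wx _; rewrite AE in_setC.
have := enum_uniq (mem W); have := mem_enum (mem W); move: W3; rewrite cardE.
case: (enum _) => [|w1 [|w2 [|w3 [|//]]]] // _ WE.
rewrite /= !inE negb_or andbT => /andP[/andP[n12 n13] n23].
have [|u1 Au1 wu1] := W_adj w1; first by rewrite -WE !inE eqxx.
have [|u2 Au2 wu2] := W_adj w2; first by rewrite -WE !inE eqxx ?orbT.
have [|u3 Au3 wu3] := W_adj w3; first by rewrite -WE !inE eqxx ?orbT.
have memA v : (v \in A) = [&& v != w1, v != w2 & v != w3].
  by rewrite AE in_setC -WE !inE !negb_or.
(* Each pendant vertex is hung back on its neighbour. For every path metric in the combination the
   outcome is dominated by a tripod metric. *)
pose F d := attach w3 u3 (attach w2 u2 (attach w1 u1 d)).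
suff hF : hull predT (tail_metric m.+4) (F (dist G)).
  have d_sym : dist G =2 (fun x y => dist G y x) by move=> *; exact: dist_sym.
  apply: hull_le hF _ => a b _ _.
  by do 3?[apply: le_attach; rewrite ?distvv //; first by move=> v; exact: dist_adj].
apply: (@hull_map _ (mem A) predT (path_metric (mem A) m) _ F) A_hull; last first.
  move=> k1 k2 d1 d2 d3 _ le_d a b _ _.
  apply: (@attach_mix _ [predU1 w2 & [predU1 w1 & mem A]]);
    [by rewrite !inE Au3 !orbT| |by rewrite !inE memA; do 3!case: eqP
    |by rewrite !inE memA; do 3!case: eqP].
  apply: (@attach_mix _ [predU1 w1 & mem A]); first by rewrite !inE Au2 !orbT.
  by apply: attach_mix.
move=> d0 [g [g_inj g_le d0E]].
pose c v := if v == w1 then g u1 else if v == w2 then g u2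
  else if v == w3 then g u3 else g v.
pose h v : nat := v \notin A.
have T : tripod m w1 w2 w3 (g u1) (g u2) (g u3) g c h.
  split=> //.
  - move=> v v1 v2 v3; have Av : v \in A by rewrite memA v1 v2.
    by rewrite /c /h Av (negPf v1) (negPf v2) (negPf v3); split=> //; exact: g_le.
  - by move=> u v x1 x2 x3 y1 y2 y3; apply: g_inj; rewrite /= memA ?x1 ?x2 ?y1 ?y2.
  - rewrite /c !eqxx [w2 == w1]eq_sym [w3 == w1]eq_sym [w3 == w2]eq_sym.
    by rewrite (negPf n12) (negPf n13) (negPf n23).
  - by rewrite /h !memA !eqxx ?andbF.
have hc : hull predT (tail_metric m.+4) (comb c h).
  by apply: tripod_hull T => //; exact: g_le.
apply: hull_le hc _ => a b _ _; move: a b.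
have [_ _ _ [c1 c2 c3] [h1 h2 h3]] := T.
have cA v : v \in A -> c v = g v /\ h v = 0.
  move=> Av; split; last by rewrite /h Av.
  by move: Av; rewrite memA /c => /and3P[/negPf-> /negPf-> /negPf->].
have all_in v : v \in [predU1 w3 & [predU1 w2 & [predU1 w1 & mem A]]].
  by rewrite !inE memA; do 3!case: eqP.
suff H : {in [predU1 w3 & [predU1 w2 & [predU1 w1 & mem A]]] &,
    forall a b, F d0 a b <= comb c h a b} by move=> a b; exact: H.
have [cu1 hu1] := cA _ Au1; have [cu2 hu2] := cA _ Au2; have [cu3 hu3] := cA _ Au3.
apply: attach_comb; rewrite ?c3 ?h3 ?cu3 ?hu3 //; first by rewrite !inE Au3 !orbT.
apply: attach_comb; rewrite ?c2 ?h2 ?cu2 ?hu2 //; first by rewrite !inE Au2 !orbT.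
apply: attach_comb; rewrite ?c1 ?h1 ?cu1 ?hu1 // => a b Aa Ab.
rewrite d0E // /comb; have [-> ->] := cA _ Aa; have [-> ->] := cA _ Ab.
exact: leqnn.
Qed.
End Distance.

(** * Top eigenvectors of the extremal tree *)

Local Open Scope ring_scope.

Definition tail_dist n : nat -> nat -> nat := comb (tail_pos n) (tail_height n).

Lemma tail_dist_lt m k j : (k <= m.+1)%N -> (j < k)%N ->
  tail_dist m.+4 k j = (tail_dist m.+4 k.-1 j).+1.
Proof.
move=> k_le jk; rewrite /tail_dist /comb /tail_pos /tail_height /=.
by do ![case: eqP => /= ?]; lia.
Qed.

(** The additional leaf [m.+3] also counts as lying beyond [k], since it hangs on position
    [m.+1]. *)
Lemma tail_dist_ge m k j : (0 < k <= m.+1)%N -> (k <= j < m.+4)%N ->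
  tail_dist m.+4 k.-1 j = (tail_dist m.+4 k j).+1.
Proof.
move=> k_le jk; rewrite /tail_dist /comb /tail_pos /tail_height /=.
by do ![case: eqP => /= ?]; lia.
Qed.

Lemma tail_dist_twin m a j : (m.+1 < a < m.+4)%N -> (j < m.+4)%N -> j <> a ->
  tail_dist m.+4 a j = (tail_dist m.+4 m.+1 j).+1.
Proof.
move=> a_gt j_lt; rewrite /tail_dist /comb /tail_pos /tail_height /=.
by do ![case: eqP => /= ?]; lia.
Qed.

Lemma tail_dist_twin1 m a : (m.+1 < a < m.+4)%N -> tail_dist m.+4 m.+1 a = 1%N.
Proof.
move=> a_gt; rewrite /tail_dist /comb /tail_pos /tail_height /=.
by do ![case: eqP => /= ?]; lia.
Qed.

Section TailEigenvector.
Variables (R : realDomainType) (m : nat).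
Let n := m.+4.
Hypothesis m_gt0 : (0 < m)%N.
Let tau i j : R := (tail_dist n i j)%:R.

Definition tail_trans (i : nat) : R := \sum_(j < m.+4) (tail_dist m.+4 i j)%:R.
Definition tail_eig (rho : R) (y : nat -> R) := forall i, (i < m.+4)%N ->
  \sum_(j < m.+4) (tail_dist m.+4 i j)%:R * (y i - y j) = rho * y i.
Definition tail_decr (y : nat -> R) :=
  (forall i j, (i < j <= m.+2)%N -> y j < y i) /\ y m.+3 = y m.+2.

Variable rho : R.
(** Both bounds come from Rayleigh quotients: of a unit vector, and of the difference of the unit
    vectors at the ends of the longest path, which are [m.+2] apart. *)
Hypothesis rho_gt : forall i, (i < n)%N -> tail_trans i < rho.
Hypothesis rho_ge : tail_trans 0 + tail_trans m.+2 + (2 * m.+2)%:R <= 2 * rho.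

Let r i := rho - tail_trans i.
Let sg k j : R := if (j < k)%N then 1 else -1.

Lemma tau_step k j : (0 < k <= m.+1)%N -> (j < n)%N -> tau k j = tau k.-1 j + sg k j.
Proof.
move=> k_le j_lt; rewrite /tau /sg; case: ltnP => jk.
  by rewrite (tail_dist_lt _ jk) ?natr1 //; case/andP: k_le.
by rewrite (tail_dist_ge k_le) ?jk // -natr1 addrK.
Qed.

Lemma tau_twin a j : (m.+1 < a < n)%N -> (j < n)%N ->
  tau a j = tau m.+1 j + 1 - (if j == a then 2 else 0).
Proof.
move=> a_gt j_lt; rewrite /tau; have [->|/eqP ja] := eqVneq j a.
  by rewrite tail_dist_twin1 // /tail_dist /comb eqxx; ring.
by rewrite (tail_dist_twin a_gt) // -natr1; ring.
Qed.

Lemma sum_sg k : (k <= n)%N -> \sum_(j < n) sg k j = 2 * k%:R - n%:R.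
Proof.
move=> k_le; rewrite -(big_mkord xpredT (sg k)) (big_cat_nat (n := k)) //=.
rewrite (eq_big_nat _ _ (F2 := fun=> 1)); last by move=> i /andP[_ ik]; rewrite /sg ik.
rewrite [X in _ + X](eq_big_nat _ _ (F2 := fun=> -1)); last first.
  by move=> i /andP[ki _]; rewrite /sg ltnNge ki.
by rewrite !sumr_const_nat subn0 mulNrn natrB //; ring.
Qed.

Lemma r_step k : (0 < k <= m.+1)%N -> r k = r k.-1 + n%:R - 2 * k%:R.
Proof.
move=> k_le; rewrite /r /tail_trans.
rewrite (eq_bigr (fun j : 'I_n => tau k.-1 j + sg k j)); last first.
  by move=> j _; rewrite -tau_step.
rewrite big_split /= sum_sg; last by rewrite /n; lia.
by rewrite /tau; ring.
Qed.

Lemma sum_delta a (c : R) : (a < n)%N ->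
  \sum_(j < n) (if j == a :> nat then c else 0) = c.
Proof.
move=> a_lt; rewrite (bigD1 (Ordinal a_lt)) //= eqxx big1 ?addr0 // => j ja.
by case: eqP => // jaE; case/eqP: ja; apply/val_inj.
Qed.

Lemma r_twin a : (m.+1 < a < n)%N -> r a = r m.+1 - m.+2%:R.
Proof.
move=> a_gt; rewrite /r /tail_trans.
rewrite (eq_bigr (fun j : 'I_n =>
    tau m.+1 j + 1 - (if j == a :> nat then 2 else 0))); last first.
  by move=> j _; rewrite -tau_twin.
rewrite sumrB big_split /= sumr_const card_ord.
have a_lt : (a < n)%N by case/andP: a_gt.
by rewrite sum_delta // /tau /n -!natr1; ring.
Qed.

Lemma r_closed k : (k <= m.+1)%N -> r k = r 0 + k%:R * n%:R - k%:R * (k%:R + 1).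
Proof.
elim: k => [|k IHk] k_le; first by ring.
by rewrite r_step //= IHk ?(ltnW k_le) // -!natr1; ring.
Qed.

(** [rho_ge] reads [r 0 + r m.+2 >= 2 * m.+2], and [r m.+2 = r 0 + m]; hence
    [r m.+2 >= (3 * m + 4) / 2], which exceeds 2. So [y_twin] can be solved for the values at the
    twin leaves. *)
Lemma r_twin_gt2 a : (m.+1 < a < n)%N -> 2 < r a.
Proof.
move=> a_gt; have lt2 : (m.+1 < m.+2 < n)%N by rewrite /n; lia.
have -> : r a = r m.+2 by rewrite (r_twin a_gt) (r_twin lt2).
have ge : r 0 + r m.+2 >= (2 * m.+2)%:R.
  by move: rho_ge; rewrite /r; lra.
have : r m.+2 = r 0 + m%:R.
  by rewrite (r_twin lt2) r_closed // /n -!natr1; ring.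
have : 1 <= m%:R :> R by rewrite ler1n.
move: ge; rewrite natrM -!natr1; lra.
Qed.

Lemma r_gt0 i : (i < n)%N -> 0 < r i.
Proof. by move=> /rho_gt; rewrite subr_gt0. Qed.

Section Eig.
Variable y : nat -> R.
Hypothesis y_eig : tail_eig rho y.

(** When all eigenvalue equations are added, the left-hand sides cancel by antisymmetry, and [rho]
    is positive. *)
Lemma sum_y0 : \sum_(j < n) y j = 0.
Proof.
have rho_gt0 : 0 < rho.
  by apply: le_lt_trans (rho_gt (ltn0Sn _)); apply: sumr_ge0.
have E : \sum_(i < n) \sum_(j < n) tau i j * (y i - y j) = rho * \sum_(j < n) y j.
  by rewrite mulr_sumr; apply: eq_bigr => i _; apply: y_eig.
have E' : \sum_(i < n) \sum_(j < n) tau i j * (y i - y j) =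
    - \sum_(i < n) \sum_(j < n) tau i j * (y i - y j).
  rewrite {1}exchange_big -sumrN; apply: eq_bigr => i _; rewrite -sumrN.
  apply: eq_bigr => j _; rewrite -mulrN opprB; congr (_%:R * _).
  by rewrite /tail_dist /comb eq_sym; case: eqP => // _; lia.
have : rho * \sum_(j < n) y j = 0 by rewrite -E; lra.
by move/eqP; rewrite mulf_eq0 (gt_eqF rho_gt0) /= => /eqP.
Qed.

Lemma row_eq i : (i < n)%N -> r i * y i = - \sum_(j < n) tau i j * y j.
Proof.
move=> i_lt; have := y_eig i_lt.
rewrite (eq_bigr (fun j : 'I_n => tau i j * y i - tau i j * y j)); last first.
  by move=> j _; rewrite mulrBr.
by rewrite sumrB -mulr_suml -/(tail_trans i) /r mulrBl => <-; ring.
Qed.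

Let S k := \sum_(j < k) y j.

Lemma sum_sg_y k : (k <= n)%N -> \sum_(j < n) sg k j * y j = 2 * S k.
Proof.
move=> k_le; have := sum_y0; rewrite /S.
rewrite -!(big_mkord xpredT) -(big_mkord xpredT (fun j => sg k j * y j)).
rewrite (big_cat_nat (n := k)) //= => y0; rewrite (big_cat_nat (n := k)) //=.
rewrite (eq_big_nat _ _ (F2 := y)); last by move=> i /andP[_ ik]; rewrite /sg ik mul1r.
rewrite [X in _ + X = _](eq_big_nat _ _ (F2 := fun j => - y j)); last first.
  by move=> i /andP[ki _]; rewrite /sg ltnNge ki mulN1r.
rewrite sumrN; lra.
Qed.

(** Rows [k] and [k.-1] differ by the signs [sg k]; as [y] sums to 0, the signed sum is twice a
    partial sum. *)
Lemma y_step k : (0 < k <= m.+1)%N -> r k * y k = r k.-1 * y k.-1 - 2 * S k.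
Proof.
move=> k_le; have k_lt : (k < n)%N by rewrite /n; lia.
have k1_lt : (k.-1 < n)%N by rewrite /n; lia.
rewrite !row_eq // -(sum_sg_y (ltnW k_lt)) -opprD -big_split /=; congr (- _).
by apply: eq_bigr => j _; rewrite tau_step // mulrDl.
Qed.

(** Row [a] exceeds row [m.+1] by 1 except in entry [a], where the difference is -1; this defect is
    the 2 subtracted from [r a]. *)
Lemma y_twin a : (m.+1 < a < n)%N -> (r a - 2) * y a = r m.+1 * y m.+1.
Proof.
move=> a_gt; have a_lt : (a < n)%N by case/andP: a_gt.
have m1_lt : (m.+1 < n)%N by rewrite /n; lia.
rewrite mulrBl (row_eq a_lt) (row_eq m1_lt).
rewrite (eq_bigr (fun j : 'I_n =>
    tau m.+1 j * y j + y j - (if j == a :> nat then 2 * y a else 0))); last first.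
  by move=> j _; rewrite tau_twin //; have [->|_] := eqVneq (j : nat) a; ring.
by rewrite sumrB big_split /= sum_y0 sum_delta //; ring.
Qed.

(* The quantity [gap k] is [r k * (y k.-1 - y k)], and [gap k.+1 * r k] equals
   [gap k * r k.-1]; so all differences along the path have the sign of [y 0]. *)
Let gap k := (n%:R - 2 * k%:R) * y k.-1 + 2 * S k.

Lemma gapE k : (0 < k <= m.+1)%N -> gap k = r k * (y k.-1 - y k).
Proof. by move=> k_le; rewrite mulrBr y_step // r_step // /gap; ring. Qed.

Lemma gap1 : gap 1 = n%:R * y 0.
Proof. by rewrite /gap /S big_ord_recl big_ord0 /= addr0; ring. Qed.

Lemma gapS k : (0 < k <= m.+1)%N -> r k * gap k.+1 = r k.-1 * gap k.
Proof.
move=> k_le; have gE := gapE k_le; have rE := r_step k_le.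
have -> : gap k.+1 = gap k - (n%:R - 2 * k%:R) * (y k.-1 - y k).
  by rewrite /gap /S big_ord_recr /= -natr1; ring.
rewrite mulrBr mulrCA -gE rE; ring.
Qed.

Lemma y_path_gt k : 0 < y 0 -> (0 < k <= m.+1)%N -> y k < y k.-1.
Proof.
move=> y0; have gap_gt0 j : (0 < j <= m.+1)%N -> 0 < gap j.
  elim: j => // j IHj; have [->|j_gt0] := posnP j.
    by rewrite gap1 mulr_gt0 ?ltr0n.
  move=> j_le; have j_in : (0 < j <= m.+1)%N by lia.
  have := gapS j_in; have rj : 0 < r j by apply: r_gt0; rewrite /n; lia.
  have rj1 : 0 < r j.-1 by apply: r_gt0; rewrite /n; lia.
  by move=> E; rewrite -(pmulr_rgt0 _ rj) E mulr_gt0 // IHj.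
move=> k_le; have rk : 0 < r k by apply: r_gt0; rewrite /n; lia.
by have := gap_gt0 k k_le; rewrite gapE // (pmulr_rgt0 _ rk) subr_gt0.
Qed.

Lemma y_path_eq0 k : y 0 = 0 -> (k <= m.+1)%N -> y k = 0.
Proof.
move=> y0; have gap_eq0 j : (0 < j <= m.+1)%N -> gap j = 0.
  elim: j => // j IHj; have [->|j_gt0] := posnP j; first by rewrite gap1 y0 mulr0.
  move=> j_le; have j_in : (0 < j <= m.+1)%N by lia.
  have rj : 0 < r j by apply: r_gt0; rewrite /n; lia.
  have := gapS j_in; rewrite IHj // mulr0 => /eqP.
  by rewrite mulf_eq0 (gt_eqF rj) => /eqP.
elim: k => // k IHk k_le; have := gapE (k := k.+1) k_le.
rewrite gap_eq0 //= IHk ?(ltnW k_le) // sub0r => /esym/eqP.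
have rk : 0 < r k.+1 by apply: r_gt0; rewrite /n; lia.
by rewrite mulf_eq0 (gt_eqF rk) oppr_eq0 => /eqP.
Qed.

Lemma y_twin_eq : y m.+3 = y m.+2.
Proof.
have lt2 : (m.+1 < m.+2 < n)%N by rewrite /n; lia.
have lt3 : (m.+1 < m.+3 < n)%N by rewrite /n; lia.
have r2 := r_twin_gt2 lt2.
have := y_twin lt3; rewrite -(y_twin lt2) (r_twin lt3) -(r_twin lt2) => /mulfI; apply.
by rewrite gt_eqF // subr_gt0.
Qed.

Lemma y_decr : 0 < y 0 -> tail_decr y.
Proof.
move=> y0; have dec := y_path_gt y0.
have dec2 i j : (i < j <= m.+1)%N -> y j < y i.
  elim: j => // j IHj ij; have [->|ne] := eqVneq i j; first by apply: (dec j.+1); lia.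
  by apply: lt_trans (dec j.+1 _) (IHj _) => /=; lia.
have lt2 : (m.+1 < m.+2 < n)%N by rewrite /n; lia.
have r2 := r_twin_gt2 lt2; have r1 : 0 < r m.+1 by apply: r_gt0; rewrite /n; lia.
have tw := y_twin lt2; have rt := r_twin lt2.
(* Otherwise all entries would be nonnegative and [y 0] positive, against [sum_y0]. *)
have y1_lt0 : y m.+1 < 0.
  rewrite ltNge; apply/negP => y1.
  have y2 : 0 <= y m.+2.
    rewrite -(pmulr_rge0 _ (_ : 0 < r m.+2 - 2)) ?subr_gt0 // tw.
    by rewrite mulr_ge0 // ltW.
  have s0 : \sum_(i < m.+1) y i + y m.+1 + y m.+2 + y m.+2 = 0.
    by have := sum_y0; rewrite /n 3!big_ord_recr /= y_twin_eq.
  have : 0 < \sum_(i < m.+1) y i.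
    rewrite big_ord_recl ltr_wpDr //; apply: sumr_ge0 => i _.
    apply: le_trans y1 (ltW (dec2 _ _ _)).
    by rewrite /= /bump /=; have := ltn_ord i; lia.
  lra.
have lt21 : y m.+2 < y m.+1.
  rewrite -subr_gt0 -(pmulr_rgt0 _ (_ : 0 < r m.+2 - 2)) ?subr_gt0 //.
  have -> : (r m.+2 - 2) * (y m.+1 - y m.+2) = n%:R * - y m.+1.
    by rewrite mulrBr tw rt /n -!natr1; ring.
  by rewrite mulr_gt0 ?ltr0n // oppr_gt0.
split; last exact: y_twin_eq.
move=> i j ij; have [->|ne] := eqVneq j m.+2; last by apply: dec2; lia.
have [->//|ne1] := eqVneq i m.+1; apply: lt_trans lt21 (dec2 _ _ _); lia.
Qed.

End Eig.

(** The sign of [y 0] decides the direction. If [y 0] vanishes, so do all gaps, hence the values on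
    the path and, by [y_twin], at the leaves. *)
Lemma tail_eigvec y : tail_eig rho y -> (exists2 i, (i < n)%N & y i != 0) ->
  tail_decr y \/ tail_decr (fun i => - y i).
Proof.
move=> y_eig [i i_lt yi]; have [y0|y0|y0] := ltgtP 0 (y 0).
- by left; exact: y_decr.
- right; apply: y_decr; last by rewrite oppr_gt0.
  move=> j j_lt; rewrite mulrN -y_eig // -sumrN; apply: eq_bigr => k _; ring.
case/eqP: yi; have path0 := y_path_eq0 y_eig (esym y0).
have tw a : (m.+1 < a < n)%N -> y a = 0.
  move=> a_gt; have := y_twin y_eig a_gt; rewrite (path0 m.+1) // mulr0 => /eqP.
  by rewrite mulf_eq0 subr_eq0 gt_eqF ?r_twin_gt2 // => /eqP.
by have [/path0|ltm] := leqP i m.+1; last by apply: tw; rewrite ltm.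
Qed.

End TailEigenvector.

(** * Rayleigh quotients *)

From mathcomp Require Import all_classical all_reals.
From mathcomp Require topology normedtype derive.

Section Rayleigh.
Import topology normedtype derive numFieldNormedType.Exports.
Local Open Scope classical_set_scope.
Variables (R : realType) (n : nat).
Implicit Types (A : 'M[R]_n) (x y z : 'rV[R]_n).

Definition bilin A x y : R := (x *m A *m y^T) 0 0.
Definition sqnorm x : R := \sum_i x 0 i ^+ 2.

Lemma bilinDl A x y z : bilin A (x + y) z = bilin A x z + bilin A y z.
Proof. by rewrite /bilin !mulmxDl mxE. Qed.

Lemma bilinDr A x y z : bilin A z (x + y) = bilin A z x + bilin A z y.
Proof. by rewrite /bilin linearD mulmxDr mxE. Qed.

Lemma bilinZl A t x y : bilin A (t *: x) y = t * bilin A x y.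
Proof. by rewrite /bilin -!scalemxAl mxE. Qed.

Lemma bilinZr A t x y : bilin A y (t *: x) = t * bilin A y x.
Proof. by rewrite /bilin linearZ -scalemxAr mxE. Qed.

Lemma bilinC A x y : A^T = A -> bilin A x y = bilin A y x.
Proof.
move=> A_sym; rewrite /bilin; have -> : y *m A *m x^T = (x *m A *m y^T)^T.
  by rewrite !trmx_mul trmxK A_sym mulmxA.
by rewrite [RHS]mxE.
Qed.

Lemma sqnormE x : sqnorm x = (x *m x^T) 0 0.
Proof. by rewrite mxE; apply: eq_bigr => i _; rewrite mxE expr2. Qed.

Lemma sqnorm_ge0 x : 0 <= sqnorm x.
Proof. by apply: sumr_ge0 => i _; exact: sqr_ge0. Qed.

Lemma sqnorm_eq0 x : (sqnorm x == 0) = (x == 0).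
Proof.
apply/idP/eqP => [|->]; last by rewrite /sqnorm big1 // => i _; rewrite mxE expr0n.
rewrite psumr_eq0 => [/allP x0|i _]; last exact: sqr_ge0.
apply/rowP => i; rewrite mxE; apply/eqP; rewrite -sqrf_eq0.
exact: (x0 i (mem_index_enum _)).
Qed.

Lemma sqnormZ t x : sqnorm (t *: x) = t ^+ 2 * sqnorm x.
Proof. by rewrite /sqnorm mulr_sumr; apply: eq_bigr => i _; rewrite mxE exprMn. Qed.

Lemma bilinE A x : bilin A x x = \sum_j (\sum_i x 0 i * A i j) * x 0 j.
Proof.
by rewrite /bilin mxE; apply: eq_bigr => j _; rewrite !mxE.
Qed.

Lemma bilin_shift A r x : bilin (r%:M - A) x x = r * sqnorm x - bilin A x x.
Proof.
rewrite sqnormE /bilin mulmxBr mulmxBl mul_mx_scalar -scalemxAl [LHS]mxE.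
by rewrite [X in X + _]mxE [X in _ + X]mxE.
Qed.

(* A form that is nonnegative and vanishes at [x] has [x] in its kernel: look at
   it along the line through [x] in the direction [x *m A]. *)
Lemma psd_kernel A x : A^T = A -> (forall y, 0 <= bilin A y y) ->
  bilin A x x = 0 -> x *m A = 0.
Proof.
move=> A_sym psd xA0; set w := x *m A; apply/eqP; rewrite -sqnorm_eq0.
have bxw : bilin A x w = sqnorm w by rewrite /bilin sqnormE.
have w_ge0 := sqnorm_ge0 w; have q_ge0 := psd w.
set N := sqnorm w in w_ge0 bxw *; set q := bilin A w w in q_ge0.
have q1_gt0 : 0 < q + 1 by lra.
(* The minimiser on this line would be [N / q], but [q] may vanish. With [q + 1] the form takes the
   value [- s ^+ 2 * (q + 2)], which forces [s = 0]. *)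
have := psd (x - (N / (q + 1)) *: w).
rewrite -scaleNr !(bilinDl, bilinDr, bilinZl, bilinZr) xA0 (bilinC w x A_sym) bxw -/q.
set s := N / (q + 1) => h.
have NE : N = s * (q + 1) by rewrite divfK // gt_eqF.
have s_ge0 : 0 <= s by rewrite divr_ge0 // ltW.
rewrite NE in h *.
have : s ^+ 2 * (q + 2) <= 0 by nra.
rewrite pmulr_lle0; last lra.
by rewrite le_eqVlt ltNge sqr_ge0 orbF sqrf_eq0 => /eqP->; rewrite mul0r.
Qed.

Lemma form_max_eigen A r x : A^T = A -> (forall y, bilin A y y <= r * sqnorm y) ->
  bilin A x x = r * sqnorm x -> x *m A = r *: x.
Proof.
move=> A_sym ray xE; have : x *m (r%:M - A) = 0.
  apply: psd_kernel; last by rewrite bilin_shift xE subrr.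
    by rewrite linearB /= tr_scalar_mx A_sym.
  by move=> y; rewrite bilin_shift subr_ge0.
by rewrite mulmxBr mul_mx_scalar => /eqP; rewrite subr_eq0 => /eqP.
Qed.

Lemma continuous_sum (T : topologicalType) (F : 'I_n -> T -> R) :
  (forall i, continuous (F i)) -> continuous (fun t => \sum_i F i t).
Proof.
by move=> cF; apply: (continuous_big (P := xpredT)) => //; exact: add_continuous.
Qed.

Lemma continuous_sqnorm : continuous sqnorm.
Proof.
apply: continuous_sum => i x; pose coord (z : 'rV[R]_n) := z 0 i.
by apply: (@continuousM _ _ coord coord); exact: coord_continuous.
Qed.

Lemma continuous_bilin A : continuous (fun x => bilin A x x).
Proof.
have -> : (fun x => bilin A x x) =
    fun x => \sum_j (\sum_i x 0 i * A i j) * x 0 j.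
  by apply/funext => x; exact: bilinE.
apply: continuous_sum => j x.
pose col (z : 'rV[R]_n) := \sum_i z 0 i * A i j.
apply: (@continuousM _ _ col (fun z => z 0 j)); last exact: coord_continuous.
apply: continuous_sum => i {}x.
apply: (@continuousM _ _ (fun x : 'rV[R]_n => x 0 i) (fun=> A i j)).
  exact: coord_continuous.
exact: cst_continuous.
Qed.

Lemma compact_sphere : compact [set x : 'rV[R]_n | sqnorm x = 1].
Proof.
have cube : compact [set v : 'rV[R]_n | forall i, v ord0 i \in `[-1, 1]%R].
  exact: (@rV_compact R n (fun=> `[(- (1 : R)), 1]) (fun=> @segment_compact R _ _)).
apply: subclosed_compact cube _.
  move: continuous_sqnorm => /continuous_closedP /(_ [set r | r = 1]); apply.
  exact: closed_eq.
move=> x /= x1 i; rewrite in_itv /= -ler_norml -(@ler_pXn2r _ 2) ?nnegrE //.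
rewrite real_normK ?num_real // expr1n -x1 /sqnorm (bigD1 i) //=.
by rewrite lerDl sumr_ge0 // => j _; exact: sqr_ge0.
Qed.

(** The form attains a maximum on the compact unit sphere; scaling extends the bound to all vectors,
    and [form_max_eigen] makes the maximiser an eigenvector. *)
Lemma rayleigh_max A : (0 < n)%N -> A^T = A ->
  exists2 x : 'rV[R]_n, x != 0 &
    exists2 r : R, x *m A = r *: x & forall y, bilin A y y <= r * sqnorm y.
Proof.
move=> n_gt0 A_sym.
have [||c c1 cmax] := @EVT_max_rV R n (fun x => bilin A x x)
    [set x | sqnorm x = 1] _ compact_sphere.
- exists (delta_mx 0 (Ordinal n_gt0)); rewrite /= /sqnorm (bigD1 (Ordinal n_gt0)) //=.
  rewrite big1 ?addr0 => [|i ni]; first by rewrite mxE !eqxx expr1n.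
  by rewrite mxE (negPf ni) andbF expr0n.
- by apply: continuous_subspaceT; exact: continuous_bilin.
rewrite inE /= in c1; set r := bilin A c c in cmax.
have ray y : bilin A y y <= r * sqnorm y.
  have [->|y0] := eqVneq y 0.
    by rewrite /bilin !mul0mx mxE /sqnorm big1 ?mulr0 // => i _; rewrite mxE expr0n.
  have y_gt0 : 0 < sqnorm y by rewrite lt_def sqnorm_eq0 y0 sqnorm_ge0.
  set s := Num.sqrt (sqnorm y).
  have s_gt0 : 0 < s by rewrite sqrtr_gt0.
  have s2 : s ^+ 2 = sqnorm y by rewrite sqr_sqrtr // sqnorm_ge0.
  have := cmax (s^-1 *: y); rewrite inE /= sqnormZ exprVn s2 mulVf ?gt_eqF //.
  move=> /(_ erefl); rewrite bilinZl bilinZr mulrA -expr2 exprVn s2.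
  by rewrite mulrC ler_pdivrMr.
exists c; first by rewrite -sqnorm_eq0 c1 oner_eq0.
by exists r => //; apply: form_max_eigen => //; rewrite c1 mulr1.
Qed.

(** The Rayleigh maximum is an eigenvalue, and evaluating the form at eigenvectors shows that it
    bounds all eigenvalues. *)
Lemma sup_eigenvalueP A : (0 < n)%N -> A^T = A ->
  let r := sup [set a : R | eigenvalue A a] in
  [/\ exists2 x : 'rV[R]_n, x != 0 & x *m A = r *: x,
      forall y, bilin A y y <= r * sqnorm y &
      forall y, bilin A y y = r * sqnorm y -> y *m A = r *: y].
Proof.
move=> n_gt0 A_sym r; have [x x0 [r0 xA ray]] := rayleigh_max n_gt0 A_sym.
have -> : r = r0.
  have r0_ub : ubound [set a : R | eigenvalue A a] r0.
    move=> a /eigenvalueP[y yA y0]; have := ray y.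
    rewrite /bilin yA -scalemxAl mxE -sqnormE ler_pM2r //.
    by rewrite lt_def sqnorm_eq0 y0 sqnorm_ge0.
  have r0_eig : [set a : R | eigenvalue A a] r0 by apply/eigenvalueP; exists x.
  by apply/eqP; rewrite eq_le ge_sup ?(ub_le_sup _ r0_eig) //; exists r0.
split=> //; first by exists x.
by move=> y; exact: form_max_eigen.
Qed.

End Rayleigh.

(** * The quadratic form of the distance Laplacian *)

Section Energy.
Variables (R : realType) (V : finType).
Implicit Types (d : V -> V -> nat) (x : V -> R).

(** The sum runs over ordered pairs, so for a graph distance it is twice the quadratic form of the
    distance Laplacian. *)
Definition energy d x : R := \sum_u \sum_v (d u v)%:R * (x u - x v) ^+ 2.
Definition sumsq x : R := \sum_u x u ^+ 2.
Definition eigfun d (rho : R) x :=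
  forall u, \sum_v (d u v)%:R * (x u - x v) = rho * x u.

Lemma energyE d x : d =2 (fun u v => d v u) ->
  energy d x = 2 * \sum_u (\sum_v (d u v)%:R * (x u - x v)) * x u.
Proof.
move=> d_sym; set E := \sum_u _.
have E2 : E = \sum_u \sum_v (d u v)%:R * (x v - x u) * x v.
  rewrite exchange_big; apply: eq_bigr => u _; rewrite mulr_suml.
  by apply: eq_bigr => v _; rewrite d_sym.
rewrite mulr_natl mulr2n {2}E2 -big_split; apply: eq_bigr => u _ /=.
rewrite mulr_suml -big_split; apply: eq_bigr => v _ /=; ring.
Qed.

Lemma eigfun_energy d rho x : d =2 (fun u v => d v u) -> eigfun d rho x ->
  energy d x = 2 * rho * sumsq x.
Proof.
move=> d_sym x_eig; rewrite energyE // -mulrA; congr (_ * _).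
by rewrite /sumsq mulr_sumr; apply: eq_bigr => u _; rewrite x_eig expr2 mulrA.
Qed.

End Energy.

Section Laplacian.
Variables (R : realType) (n : nat) (G : sgraph 'I_n).
Hypothesis G_conn : connected G.
Let L := distance_laplacian R G.
Let d := dist G.
Let d_sym : d =2 (fun u v => d v u). Proof. by move=> u v; exact: dist_sym. Qed.

Lemma laplacianE i j : L i j = (transmission G i)%:R *+ (i == j) - (d i j)%:R.
Proof. by rewrite !mxE. Qed.

Lemma laplacian_sym : L^T = L.
Proof.
apply/matrixP => i j; rewrite mxE !laplacianE d_sym eq_sym.
by have [->|//] := eqVneq i j.
Qed.

Lemma laplacian_row (x : 'I_n -> R) j :
  ((\row_i x i) *m L) 0 j = \sum_v (d j v)%:R * (x j - x v).
Proof.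
rewrite mxE (eq_bigr (fun v =>
    (if v == j then (transmission G j)%:R * x j else 0) - (d j v)%:R * x v)).
  rewrite sumrB -big_mkcond big_pred1_eq.
  rewrite [RHS](eq_bigr (fun v => (d j v)%:R * x j - (d j v)%:R * x v)); last first.
    by move=> v _; rewrite mulrBr.
  by rewrite [RHS]sumrB -mulr_suml natr_sum.
move=> v _; rewrite mxE laplacianE d_sym.
by have [->|_] := eqVneq v j; rewrite ?mulr1n ?mulr0n; ring.
Qed.

Lemma laplacian_energy x : 2 * bilin L (\row_i x i) (\row_i x i) = energy d x.
Proof.
rewrite energyE //; congr (_ * _); rewrite bilinE; apply: eq_bigr => j _.
rewrite -laplacian_row mxE [in RHS]mxE; congr (_ * _).
Qed.

Lemma row_sqnorm (x : 'I_n -> R) : sqnorm (\row_i x i) = sumsq x.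
Proof. by apply: eq_bigr => i _; rewrite mxE. Qed.

Lemma laplacian_eig rho (x : 'I_n -> R) :
  (\row_i x i) *m L = rho *: (\row_i x i) -> eigfun d rho x.
Proof. by move=> xL j; rewrite -laplacian_row xL !mxE. Qed.

Lemma bilin_delta (A : 'M[R]_n) i j : bilin A (delta_mx 0 i) (delta_mx 0 j) = A i j.
Proof. by rewrite /bilin -rowE trmx_delta -colE !mxE. Qed.

Lemma sqnorm_delta i : sqnorm (delta_mx 0 i : 'rV[R]_n) = 1.
Proof. by rewrite sqnormE trmx_delta mul_delta_mx mxE !eqxx. Qed.

Hypothesis n_gt1 : (1 < n)%N.

Lemma rho_L_spec : let rho := rho_L R G in
  [/\ exists2 x : 'I_n -> R, exists i, x i != 0 & eigfun d rho x,
      forall x, energy d x <= 2 * rho * sumsq x,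
      forall x, energy d x = 2 * rho * sumsq x -> eigfun d rho x,
      forall i, (transmission G i)%:R < rho &
      forall i j, i != j ->
        (transmission G i)%:R + (transmission G j)%:R + (2 * d i j)%:R <= 2 * rho].
Proof.
have [[x x0 xL] ray ray_eq] := sup_eigenvalueP (ltnW n_gt1) laplacian_sym.
rewrite -/(rho_L R G) in xL ray ray_eq *; move=> rho.
have rowE' (z : 'rV[R]_n) : z = \row_i z 0 i by apply/rowP => i; rewrite mxE.
have Lii i : L i i = (transmission G i)%:R by rewrite laplacianE eqxx /d distvv subr0.
have Lij i j : i != j -> L i j = - (d i j)%:R.
  by move=> ij; rewrite laplacianE (negPf ij) sub0r.
split.
- exists (x 0); last by apply: laplacian_eig; rewrite -rowE'.
  by have /rV0Pn := x0.
- by move=> z; rewrite -laplacian_energy -row_sqnorm -mulrA ler_pM2l.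
- move=> z; rewrite -laplacian_energy -row_sqnorm -mulrA => /mulfI E.
  by apply: laplacian_eig; apply: ray_eq; apply: E; rewrite pnatr_eq0.
(* A unit vector gives the weak inequality. Equality would make it an eigenvector, but its image has
   nonzero entries [- d i j] away from [i]. *)
- move=> i; have := ray (delta_mx 0 i); rewrite bilin_delta sqnorm_delta mulr1 Lii.
  rewrite le_eqVlt => /orP[/eqP E|//].
  have := ray_eq (delta_mx 0 i); rewrite bilin_delta sqnorm_delta mulr1 Lii => /(_ E).
  have [j ji] : exists j, j != i.
    have /card_gt1P[a [b [_ _ ab]]] : (1 < #|'I_n|)%N by rewrite card_ord.
    by have [ai|ai] := eqVneq a i; [exists b; rewrite -ai eq_sym|exists a].
  move/rowP/(_ j); rewrite -rowE [LHS]mxE [RHS]mxE [X in _ * X]mxE (negPf ji) andbF mulr0.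
  rewrite Lij; last by rewrite eq_sym.
  by move/eqP; rewrite oppr_eq0 pnatr_eq0 dist_eq0 // eq_sym (negPf ji).
- move=> i j ij; have := ray (delta_mx 0 i - delta_mx 0 j).
  have -> : sqnorm (delta_mx 0 i - delta_mx 0 j : 'rV[R]_n) = 2.
    rewrite sqnormE -[_ - _ in X in X *m _]mulmx1 -/(bilin 1%:M _ _).
    rewrite -scaleN1r !(bilinDl, bilinDr, bilinZl, bilinZr) !bilin_delta !mxE !eqxx.
    by rewrite [j == i]eq_sym (negPf ij) /=; ring.
  rewrite -scaleN1r !(bilinDl, bilinDr, bilinZl, bilinZr) !bilin_delta !Lii !Lij //;
    last by rewrite eq_sym.
  by rewrite natrM [d j i]d_sym [rho * _]mulrC; lra.
Qed.

End Laplacian.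

(** * The extremal graph *)

Section Labelling.
Variables (V : finType) (n : nat) (g : V -> nat).
Hypotheses (g_inj : injective g) (g_lt : forall v, (g v < n.+1)%N).
Hypothesis cardV : #|V| = n.+1.

Lemma labelling_inv : exists2 s : nat -> V,
  forall i, (i < n.+1)%N -> g (s i) = i & cancel g s.
Proof.
pose f v : 'I_n.+1 := Ordinal (g_lt v).
have f_inj : injective f by move=> u v /(congr1 val) /g_inj.
have [f' fK f'K] : bijective f by apply: inj_card_bij; rewrite // cardV card_ord.
exists (fun i => f' (inord i)) => [i i_lt|v].
  by have := congr1 val (f'K (inord i)); rewrite /= inordK.
by rewrite -[RHS]fK; congr f'; apply/val_inj; rewrite /= inordK.
Qed.

Lemma sum_labelling (R : nmodType) (F : nat -> R) :
  \sum_v F (g v) = \sum_(i < n.+1) F i.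
Proof.
pose f v : 'I_n.+1 := Ordinal (g_lt v).
have f_inj : injective f by move=> u v /(congr1 val) /g_inj.
have f_bij : bijective f by apply: inj_card_bij; rewrite // cardV card_ord.
by rewrite (reindex f) //=; apply: onW_bij.
Qed.

Lemma card_labelling k : (k <= n.+1)%N -> #|[set v | (g v < k)%N]| = k.
Proof.
move=> k_le; rewrite -sum1_card big_mkcond /=.
under eq_bigr do rewrite inE.
rewrite (sum_labelling (fun i => if (i < k)%N then 1 else 0)%N).
by rewrite -big_mkcond -(big_ord_widen _ (fun=> 1%N) k_le) sum_nat_const card_ord muln1.
Qed.

End Labelling.

Lemma tail_dist_comb m (V : finType) (g : V -> nat) u v : injective g ->
  tail_comb m g u v = tail_dist m (g u) (g v).
Proof. by move=> g_inj; rewrite /tail_comb /tail_dist /comb /= (inj_eq g_inj). Qed.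

Lemma tail_dist0 n i : tail_dist n i i = 0%N.
Proof. by rewrite /tail_dist /comb eqxx. Qed.

Lemma tail_dist_sym n i j : tail_dist n i j = tail_dist n j i.
Proof. by rewrite /tail_dist /comb eq_sym; case: eqP => // _; lia. Qed.

Lemma tail_dist_adj m i j k : (i < m.+4)%N -> (j < m.+4)%N -> (k < m.+4)%N ->
  tail_dist m.+4 i k = 1%N -> (tail_dist m.+4 i j <= (tail_dist m.+4 k j).+1)%N.
Proof.
move=> i_lt j_lt k_lt; rewrite /tail_dist /comb /tail_pos /tail_height /=.
by do ![case: eqP => /= ?]; lia.
Qed.

(** The next vertex is [m.+1] from either twin leaf, [m.+3] from [m.+1] to that leaf, and otherwise
    one step along the path. *)
Lemma tail_dist_toward m i j : (i < m.+4)%N -> (j < m.+4)%N -> i != j ->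
  exists k, [/\ (k < m.+4)%N, tail_dist m.+4 i k = 1%N &
                tail_dist m.+4 i j = (tail_dist m.+4 k j).+1].
Proof.
move=> i_lt j_lt /eqP ij; rewrite /tail_dist /comb /tail_pos /tail_height /=.
have [i_m|i_m] := ltnP m.+1 i.
  by exists m.+1; split; [lia| |]; do ![case: eqP => /= ?]; lia.
have [ne|ne] := boolP ((j == m.+3) && (i == m.+1)).
  by exists m.+3; split; [lia| |]; do ![case: eqP => /= ?]; lia.
have [lt_ij|le_ji] := ltnP i j.
  by exists i.+1; split; [lia| |]; do ![case: eqP => /= ?]; lia.
by exists i.-1; split; [lia| |]; do ![case: eqP => /= ?]; lia.
Qed.

(* Translates the numbering of [T312] into that of [tail_pos]. *)
Definition T312_label m (v : 'I_m.+4) : nat :=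
  if v == m.+1 :> nat then 0 else if (v <= m)%N then v.+1 else v.

Lemma T312_label_inj m : injective (@T312_label m).
Proof.
move=> u v; rewrite /T312_label => uv; apply/val_inj => /=; move: uv.
by do 2!case: eqP => ?; do ?case: ltnP => ?; lia.
Qed.

Lemma T312_label_lt m (v : 'I_m.+4) : (T312_label v < m.+4)%N.
Proof.
rewrite /T312_label; have := ltn_ord v; case: (eqVneq (v : nat) m.+1) => ?; first by lia.
by case: (leqP v m) => ?; lia.
Qed.

Lemma tail_posP m i :
  [/\ i = m.+3, tail_pos m.+4 i = m.+1 & tail_height m.+4 i = 1%N] \/
  [/\ i <> m.+3, tail_pos m.+4 i = i & tail_height m.+4 i = 0%N].
Proof.
by rewrite /tail_pos /tail_height /=; case: eqP => [->|]; [left; split=> //; lia|right].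
Qed.

Lemma T312_adj m (u v : 'I_m.+4) :
  T312 m.+4 u v = (tail_dist m.+4 (T312_label u) (T312_label v) == 1%N).
Proof.
have labelP (w : 'I_m.+4) : let k := T312_label w in
    [\/ (w : nat) = m.+1 /\ [/\ k = 0, tail_pos m.+4 k = 0 & tail_height m.+4 k = 0]%N,
    (w <= m)%N /\ [/\ k = w.+1, tail_pos m.+4 k = w.+1 & tail_height m.+4 k = 0]%N,
    (w : nat) = m.+2 /\
      [/\ k = m.+2, tail_pos m.+4 k = m.+2 & tail_height m.+4 k = 0]%N |
    (w : nat) = m.+3 /\
      [/\ k = m.+3, tail_pos m.+4 k = m.+1 & tail_height m.+4 k = 1]%N].
  move=> k; have := tail_posP m k; have := ltn_ord w; rewrite /k /T312_label.
  case: (eqVneq (w : nat) m.+1) => [-> _|ne w_lt].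
    by case=> [] [? -> ->]; [lia|constructor 1].
  case: (leqP w m) => [w_le|w_gt]; first by case=> [] [? -> ->]; [lia|constructor 2].
  by case=> [] [? -> ->]; [constructor 4|constructor 3]; split=> //; try split=> //; lia.
rewrite /= /gen_adj /T312_edge -val_eqE /= /tail_dist /comb.
have := labelP u; have := labelP v => /=.
move: (T312_label u) (T312_label v) => k l.
move: (tail_pos _ k) (tail_pos _ l) (tail_height _ k) (tail_height _ l) => pk pl hk hl.
move: (nat_of_ord u) (nat_of_ord v) => i j /=.
rewrite ?subSS ?subn0.
by have [kl|kl] := eqVneq k l; case=> -[? [? ? ?]]; case=> -[? [? ? ?]]; subst;
  apply/idP/idP; lia.
Qed.

Lemma T312_dist m : connected (T312 m.+4) /\
  forall u v, dist (T312 m.+4) u v = tail_dist m.+4 (T312_label u) (T312_label v).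
Proof.
have card_m : #|'I_m.+4| = m.+4 by rewrite card_ord.
have [s sK _] := labelling_inv (@T312_label_inj m) (@T312_label_lt m) card_m.
apply: dist_unique => [u|u w v|u v uv]; first exact: tail_dist0.
  by rewrite T312_adj => /eqP uw; apply: tail_dist_adj uw; exact: T312_label_lt.
have luv : T312_label u != T312_label v by rewrite (inj_eq (@T312_label_inj m)).
have [k [k_lt uk kv]] := tail_dist_toward (T312_label_lt u) (T312_label_lt v) luv.
by exists (s k); rewrite ?T312_adj sK // uk.
Qed.

Lemma tail_dist1_neq m i j k : i != j -> tail_dist m.+4 k i = 1%N -> (i < m.+4)%N ->
  (j < m.+4)%N -> (k < m.+4)%N -> tail_dist m.+4 k j = 1%N ->
  (0 < k <= m.+1)%N.
Proof.
rewrite /tail_dist /comb; have := tail_posP m i; have := tail_posP m j; have := tail_posP m k.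
move: (tail_pos _ k) (tail_pos _ j) (tail_height _ k) (tail_height _ j) => pk pj hk hj.
move: (tail_pos _ i) (tail_height _ i) => pi hi.
case=> [][? ? ?]; case=> [][? ? ?]; case=> [][? ? ?];
  case: (eqVneq k i); case: (eqVneq k j); lia.
Qed.

Lemma tail_dist_inner m k : (0 < k <= m.+1)%N ->
  tail_dist m.+4 k k.-1 = 1%N /\ tail_dist m.+4 k k.+1 = 1%N.
Proof.
move=> k_in; rewrite /tail_dist /comb.
have := tail_posP m k; have := tail_posP m k.-1; have := tail_posP m k.+1.
move: (tail_pos _ k) (tail_pos _ k.-1) (tail_height _ k) (tail_height _ k.-1) => pk pj hk hj.
move: (tail_pos _ k.+1) (tail_height _ k.+1) => pi hi.
case=> [][? ? ?]; case=> [][? ? ?]; case=> [][? ? ?];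
  case: (eqVneq k k.-1); case: (eqVneq k k.+1); lia.
Qed.

Lemma T312_pendants m : #|pendants (T312 m.+4)| = 3%N.
Proof.
have card_m : #|'I_m.+4| = m.+4 by rewrite card_ord.
have [s sK lK] := labelling_inv (@T312_label_inj m) (@T312_label_lt m) card_m.
have s_inj i j : (i < m.+4)%N -> (j < m.+4)%N -> (s i == s j) = (i == j).
  move=> i_lt j_lt; apply/eqP/eqP => [sij|->//].
  by rewrite -(sK i) // -(sK j) // sij.
have -> : pendants (T312 m.+4) = [set s 0; s m.+2; s m.+3].
  apply/setP => v; rewrite !inE /degree -(lK v) !s_inj ?T312_label_lt //.
  set k := T312_label v; have k_lt : (k < m.+4)%N by exact: T312_label_lt.
  have adjE w : T312 m.+4 (s k) w = (tail_dist m.+4 k (T312_label w) == 1%N).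
    by rewrite T312_adj sK.
  apply/idP/idP => [/cards1P[z zE]|k_end].
    apply: contraT => k_inner; have k_in : (0 < k <= m.+1)%N by lia.
    have [d1 d2] := tail_dist_inner k_in.
    have k1_lt : (k.-1 < m.+4)%N by lia.
    have k2_lt : (k.+1 < m.+4)%N by lia.
    have : s k.-1 \in [set z] by rewrite -zE inE adjE sK // d1.
    have : s k.+1 \in [set z] by rewrite -zE inE adjE sK // d2.
    by rewrite !inE => /eqP<-; rewrite s_inj //; lia.
  have [j [j_lt dj _]] : exists j, [/\ (j < m.+4)%N, tail_dist m.+4 k j = 1%N & True].
    have [j [j_lt dj _]] : exists j, [/\ (j < m.+4)%N, tail_dist m.+4 k j = 1%N &
        tail_dist m.+4 k m.+1 = (tail_dist m.+4 j m.+1).+1].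
      by apply: tail_dist_toward => //; lia.
    by exists j.
  apply/cards1P; exists (s j); apply/setP => w.
  rewrite !inE adjE -[w in RHS]lK s_inj ?T312_label_lt //.
  apply/eqP/eqP => [dw|->//]; apply/eqP; apply: contraT => ne.
  by have := tail_dist1_neq ne dw (T312_label_lt w) j_lt k_lt dj; lia.
by rewrite -finset.setUA cardsU1 !inE cards2 !s_inj //; lia.
Qed.

Definition absdiff (a b : nat) := ((a - b) + (b - a))%N.

(** Clipping at [m.+2] identifies the twin leaves, which are equally far from every other vertex and
    at distance 2 from each other. *)
Lemma tail_dist_clip m i j : (i < m.+4)%N -> (j < m.+4)%N -> i != j ->
  tail_dist m.+4 i j = if minn i m.+2 == minn j m.+2 then 2%N
                       else absdiff (minn i m.+2) (minn j m.+2).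
Proof.
move=> i_lt j_lt ij; rewrite /tail_dist /comb (negPf ij) /absdiff.
have := tail_posP m i; have := tail_posP m j.
move: (tail_pos _ i) (tail_pos _ j) (tail_height _ i) (tail_height _ j) => pk pj hk hj.
by case=> [][? ? ?]; case=> [][? ? ?]; case: (eqVneq (minn i m.+2) (minn j m.+2)); lia.
Qed.

Lemma tail_decr_lt (R : realDomainType) m (y : nat -> R) i j :
  tail_decr m y -> (i < m.+4)%N -> (j < m.+4)%N ->
  (y i < y j) = (minn j m.+2 < minn i m.+2)%N.
Proof.
move=> [y_decr y_twin].
have yE k : (k < m.+4)%N -> y k = y (minn k m.+2).
  move=> k_lt; have [k_le|k_gt] := leqP k m.+2; first by congr y; lia.
  have -> : k = m.+3 by lia.
  by rewrite y_twin; congr y; lia.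
move=> i_lt j_lt; rewrite (yE i) // (yE j) //.
have [ji|ij|->] := ltngtP (minn j m.+2) (minn i m.+2); last by rewrite ltxx.
  by apply: y_decr; lia.
by apply/negbTE; rewrite -leNgt ltW // y_decr; lia.
Qed.

(** * Recovering the metric from the order of the eigenvector's values *)

Section TopMetric.
Variables (R : realType) (m : nat) (V : finType).
Hypothesis cardV : #|V| = m.+4.
Implicit Types (x : V -> R) (y : nat -> R) (g : V -> nat).

Definition labelled g (d : V -> V -> nat) : Prop :=
  [/\ injective g, forall v, (g v < m.+4)%N &
      d =2 fun u v => tail_dist m.+4 (g u) (g v)].

Lemma labelled_energy g d y : labelled g d ->
  energy d (y \o g) =
  \sum_(i < m.+4) \sum_(j < m.+4) (tail_dist m.+4 i j)%:R * (y i - y j) ^+ 2.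
Proof.
case=> g_inj g_lt dE; rewrite /energy /=.
rewrite -(sum_labelling g_inj g_lt cardV
  (fun i => \sum_(j < m.+4) (tail_dist m.+4 i j)%:R * (y i - y j) ^+ 2)).
apply: eq_bigr => u _.
rewrite -(sum_labelling g_inj g_lt cardV
  (fun j => (tail_dist m.+4 (g u) j)%:R * (y (g u) - y j) ^+ 2)).
by apply: eq_bigr => v _; rewrite dE.
Qed.

Lemma labelled_sumsq g d y : labelled g d ->
  sumsq (y \o g) = \sum_(i < m.+4) y i ^+ 2.
Proof.
case=> g_inj g_lt _.
by rewrite -(sum_labelling g_inj g_lt cardV (fun i => y i ^+ 2)).
Qed.

Lemma labelled_eig g d rho y : labelled g d ->
  eigfun d rho (y \o g) -> tail_eig m rho y.
Proof.
case=> g_inj g_lt dE y_eig i i_lt; have [s sK _] := labelling_inv g_inj g_lt cardV.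
rewrite -(sK i i_lt) -[RHS](y_eig (s i)).
rewrite -(sum_labelling g_inj g_lt cardV
  (fun j => (tail_dist m.+4 (g (s i)) j)%:R * (y (g (s i)) - y j))).
by apply: eq_bigr => v _; rewrite dE.
Qed.

(* When [x] decreases strictly along the longest path up to the two equal values
   at its forked end, or increases, the metric can be read off [x]. *)
Definition above x u := #|[set w | x u < x w]|.
Definition below x u := #|[set w | x w < x u]|.
Definition order_dist x u v : nat :=
  if u == v then 0 else if x u == x v then 2%N
  else minn (absdiff (above x u) (above x v)) (absdiff (below x u) (below x v)).

Lemma order_distN x u v : order_dist (fun w => - x w) u v = order_dist x u v.
Proof.
have E w : above (fun w => - x w) w = below x w.
  by apply: eq_card => z; rewrite !inE ltrN2.
have E' w : below (fun w => - x w) w = above x w.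
  by apply: eq_card => z; rewrite !inE ltrN2.
by rewrite /order_dist !E !E' eqr_opp minnC.
Qed.

(** Here [above] is the clipped position. Differences of [below] agree with it except against a twin
    leaf, where both leaves are counted and the result is 1 too large; the minimum discards this. It
    also makes [order_dist] invariant under a change of sign. *)
Lemma decr_order_dist g d y u v : labelled g d -> tail_decr m y ->
  d u v = order_dist (y \o g) u v.
Proof.
case=> g_inj g_lt dE y_decr; set x := y \o g.
have ltE a b : (x a < x b) = (minn (g b) m.+2 < minn (g a) m.+2)%N.
  exact: tail_decr_lt.
have aboveE a : above x a = minn (g a) m.+2.
  rewrite -(card_labelling g_inj g_lt cardV (k := minn (g a) m.+2)); last first.
    by have := g_lt a; lia.
  by apply: eq_card => w; rewrite !inE ltE; lia.
have belowE a : below x a = if (g a <= m.+1)%N then (m.+3 - g a)%N else 0%N.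
  case: leqP => ga.
    have := cardsC [set w | (g w < (g a).+1)%N].
    rewrite (card_labelling g_inj g_lt cardV) ?g_lt // cardV => cE.
    have -> : below x a = #|~: [set w | (g w < (g a).+1)%N]|.
      by apply: eq_card => w; rewrite !inE ltE; lia.
    lia.
  apply/eqP; rewrite cards_eq0; apply/eqP/setP => w; rewrite !inE ltE; lia.
rewrite dE /order_dist; have [->|uv] := eqVneq u v; first by rewrite tail_dist0.
rewrite tail_dist_clip ?(inj_eq g_inj) // !aboveE !belowE.
have -> : (x u == x v) = (minn (g u) m.+2 == minn (g v) m.+2).
  by rewrite eq_le !leNgt !ltE; lia.
case: eqP => // _; rewrite /absdiff.
by case: leqP => ?; case: leqP => ?; lia.
Qed.

End TopMetric.

(** * Equality in the Rayleigh bound *)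

Section Main.
Variables (R : realType) (m : nat).
Hypothesis m_gt0 : (0 < m)%N.
Let V : finType := 'I_m.+4.
Let T := T312 m.+4.
Let rho := rho_L R T.
Let cardV : #|V| = m.+4. Proof. exact: card_ord. Qed.

Lemma T312_labelled : labelled m (@T312_label m) (dist T).
Proof.
split; [exact: T312_label_inj|exact: T312_label_lt|].
by move=> u v; rewrite (T312_dist m).2.
Qed.

Let T_spec := rho_L_spec R (T312_dist m).1 isT.

Lemma T312_trans (v : V) : (transmission T v)%:R = tail_trans R m (T312_label v).
Proof.
rewrite /transmission natr_sum /tail_trans.
rewrite -(sum_labelling (@T312_label_inj m) (@T312_label_lt m) cardV
  (fun j => (tail_dist m.+4 (T312_label v) j)%:R)).
by apply: eq_bigr => w _; rewrite (T312_dist m).2.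
Qed.

(** Transporting [x] along the numbering [g] turns its energy for the copy into an energy for the
    tree itself, where the Rayleigh bound and [tail_eigvec] apply. *)
Lemma tail_metric_top (d : V -> V -> nat) (x : V -> R) : tail_metric m.+4 d ->
  energy d x <= 2 * rho * sumsq x /\
  (energy d x = 2 * rho * sumsq x -> (exists u, x u != 0) ->
   exists g y, [/\ labelled m g d, x = y \o g &
                   tail_decr m y \/ tail_decr m (fun i => - y i)]).
Proof.
case=> g [g_inj g_lt dE].
have gd : labelled m g d by split=> // u v; rewrite dE tail_dist_comb.
have [s sK gK] := labelling_inv g_inj g_lt cardV.
pose y := x \o s; have xE : x = y \o g by apply/funext => u; rewrite /y /= gK.
have [_ ray ray_eq trans_lt pair_le] := T_spec; rewrite -/rho in ray ray_eq trans_lt pair_le.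
have energyE : energy d x = energy (dist T) (y \o @T312_label m).
  by rewrite xE (labelled_energy cardV _ gd) (labelled_energy cardV _ T312_labelled).
have sumsqE : sumsq x = sumsq (y \o @T312_label m).
  by rewrite xE (labelled_sumsq cardV _ gd) (labelled_sumsq cardV _ T312_labelled).
rewrite energyE sumsqE; split=> [|E [u xu]]; first exact: ray.
have y_eig : tail_eig m rho y.
  by apply: (labelled_eig cardV T312_labelled); exact: ray_eq.
exists g, y; split=> //.
have [s' s'K _] := labelling_inv (@T312_label_inj m) (@T312_label_lt m) cardV.
apply: (@tail_eigvec R m m_gt0 rho _ _ y y_eig).
- by move=> i i_lt; rewrite -(s'K i i_lt) -T312_trans.
- have := pair_le (s' 0) (s' m.+2); rewrite !T312_trans !(T312_dist m).2 !s'K //.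
  have -> : tail_dist m.+4 0 m.+2 = m.+2.
    rewrite /tail_dist /comb; case: (tail_posP m 0) => [][? -> ->];
      case: (tail_posP m m.+2) => [][? -> ->] /=; lia.
  apply; apply/eqP => /(congr1 (@T312_label m)); rewrite !s'K //.
by exists (g u); rewrite // /y /= gK.
Qed.

End Main.

Section Main.
Variables (R : realType) (m : nat).
Hypothesis m_gt0 : (0 < m)%N.
Let V : finType := 'I_m.+4.
Let T := T312 m.+4.
Let rho := rho_L R T.
Let cardV : #|V| = m.+4. Proof. exact: card_ord. Qed.
Implicit Types (d : V -> V -> nat) (x : V -> R).

Lemma top_order_dist g d x y : labelled m g d -> x = y \o g ->
  tail_decr m y \/ tail_decr m (fun i => - y i) -> d =2 order_dist x.
Proof.
move=> gd xE y_decr u v; case: y_decr => y_decr.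
  by rewrite xE; exact: (decr_order_dist cardV u v gd).
rewrite -order_distN xE.
exact: (decr_order_dist cardV u v gd y_decr).
Qed.

(** Every copy attaining the bound has the metric [order_dist x], which depends on [x] alone;
    therefore a combination of such copies is dominated by this one metric. *)
Lemma hull_energy x d : (exists u, x u != 0) -> hull predT (tail_metric m.+4) d ->
  energy d x <= 2 * rho * sumsq x /\
  (energy d x = 2 * rho * sumsq x ->
   (forall u v, d u v <= order_dist x u v)%N /\
   exists g y, [/\ labelled m g (order_dist x), x = y \o g &
                   tail_decr m y \/ tail_decr m (fun i => - y i)]).
Proof.
move=> x0; set E := 2 * rho * sumsq x.
elim=> [{}d d_tail|k1 k2 d1 d2 {}d k_gt0 _ [le1 eq1] _ [le2 eq2] le_d].
  have [le_E eq_E] := tail_metric_top m_gt0 x d_tail; split=> // /eq_E /(_ x0).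
  case=> g [y [gd xE y_decr]]; have dE := top_order_dist gd xE y_decr.
  split=> [u v|]; first by rewrite dE.
  exists g, y; split=> //; case: gd => g_inj g_lt gE; split=> // u v.
  by rewrite -dE gE.
have k_pos : 0 < k1%:R + k2%:R :> R by rewrite -natrD ltr0n.
have mix : (k1%:R + k2%:R) * energy d x <= k1%:R * energy d1 x + k2%:R * energy d2 x.
  rewrite /energy !mulr_sumr -big_split; apply: ler_sum => u _ /=.
  rewrite !mulr_sumr -big_split; apply: ler_sum => v _ /=.
  move: (sqr_ge0 (x u - x v)); move: (_ ^+ 2) => q q_ge0.
  rewrite !mulrA -mulrDl ler_wpM2r // -natrD -!natrM -natrD ler_nat.
  exact: le_d.
have k1_ge0 : 0 <= k1%:R :> R by exact: ler0n.
have k2_ge0 : 0 <= k2%:R :> R by exact: ler0n.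
have b1 : k1%:R * energy d1 x <= k1%:R * E by exact: ler_wpM2l.
have b2 : k2%:R * energy d2 x <= k2%:R * E by exact: ler_wpM2l.
split=> [|dE]; first by rewrite -(ler_pM2l k_pos) [leRHS]mulrDl (le_trans mix) // lerD.
(* Equality passes only to summands of positive weight; one of weight 0 carries no information. *)
have e1 : (0 < k1)%N -> energy d1 x = E.
  rewrite -(ltr0n R) => k1_gt0; apply: (mulfI (lt0r_neq0 k1_gt0)).
  by move: mix; rewrite dE mulrDl; lra.
have e2 : (0 < k2)%N -> energy d2 x = E.
  rewrite -(ltr0n R) => k2_gt0; apply: (mulfI (lt0r_neq0 k2_gt0)).
  by move: mix; rewrite dE mulrDl; lra.
split=> [u v|].
  have := le_d u v isT isT.
  have h1 : (0 < k1)%N -> (d1 u v <= order_dist x u v)%N by move=> /e1/eq1[].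
  have h2 : (0 < k2)%N -> (d2 u v <= order_dist x u v)%N by move=> /e2/eq2[].
  have [k1_0|k1_gt0] := posnP k1; have [k2_0|k2_gt0] := posnP k2.
  - by move: k_gt0; rewrite k1_0 k2_0.
  - by have := h2 k2_gt0; rewrite k1_0; nia.
  - by have := h1 k1_gt0; rewrite k2_0; nia.
  - by have := h1 k1_gt0; have := h2 k2_gt0; nia.
have [k1_0|/e1/eq1[]//] := posnP k1.
by have /e2/eq2[] : (0 < k2)%N by move: k_gt0; rewrite k1_0.
Qed.

Lemma labelled_T312 (G : sgraph V) g : connected G -> labelled m g (dist G) ->
  isomorphic G (T312 m.+4).
Proof.
move=> G_conn [g_inj g_lt dE].
have [s sK gK] := labelling_inv g_inj g_lt cardV.
have [s' s'K lK] := labelling_inv (@T312_label_inj m) (@T312_label_lt m) cardV.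
exists (s' \o g) => [|u v].
  exists (s \o @T312_label m) => v /=; first by rewrite s'K ?g_lt // gK.
  by rewrite sK ?T312_label_lt // lK.
by rewrite T312_adj /= !s'K ?g_lt // -dE dist_eq1.
Qed.

(* [x] only determines the distance of the two vertices at the forked end, which
   share their value, up to an error of 1; were they adjacent, at most one vertex
   would be pendant. *)
Lemma labelled_rigid (G : sgraph V) g d : connected G -> #|pendants G| = 3%N ->
    labelled m g d -> (forall u v, dist G u v <= d u v)%N ->
    (forall u v, (minn (g u) m.+2 != minn (g v) m.+2) -> dist G u v = d u v) ->
  labelled m g (dist G).
Proof.
move=> G_conn pend3 [g_inj g_lt dE] le_d eq_d.
have [s sK gK] := labelling_inv g_inj g_lt cardV.
have adj_s i j : (i < m.+4)%N -> (j < m.+4)%N -> minn i m.+2 != minn j m.+2 ->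
    tail_dist m.+4 i j = 1%N -> G (s i) (s j).
  move=> i_lt j_lt ne dij.
  by rewrite -(dist_eq1 G_conn) (eq_d (s i) (s j)) ?dE !sK // dij.
have twins : ~~ G (s m.+2) (s m.+3).
  apply/negP => adj23.
  have : pendants G \subset [set s 0].
    apply/fintype.subsetP => w; rewrite inE -(gK w); set k := g w => k_pend.
    have k_lt : (k < m.+4)%N := g_lt w.
    have uniq_nbr i j : G (s k) (s i) -> G (s k) (s j) -> (i < m.+4)%N ->
        (j < m.+4)%N -> i = j.
      move=> ki kj i_lt j_lt; rewrite -(sK i) // -(sK j) //; congr g.
      exact: (pendant_adj k_pend ki kj).
    have [->//|k_gt0] := posnP k; exfalso.
    have [k_le|k_gt] := leqP k m.+1.
      have [d1 d2] := @tail_dist_inner m k ltac:(lia).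
      have := @uniq_nbr k.-1 k.+1; rewrite !adj_s //; lia.
    have k_twin : (m.+1 < k < m.+4)%N by lia.
    have G1 : G (s k) (s m.+1).
      by apply: adj_s; [|lia|lia|rewrite tail_dist_sym tail_dist_twin1].
    have [k2|k3] : k = m.+2 \/ k = m.+3 by lia.
      by have := @uniq_nbr m.+1 m.+3 G1; rewrite k2 => /(_ adj23); lia.
    by have := @uniq_nbr m.+1 m.+2 G1; rewrite k3 adj_sym => /(_ adj23); lia.
  by move/subset_leq_card; rewrite pend3 cards1.
split=> // u v; rewrite -dE.
have [guv|ne] := eqVneq (minn (g u) m.+2) (minn (g v) m.+2); last exact: eq_d.
have [->|uv] := eqVneq u v; first by rewrite dE distvv tail_dist0.
have guv' : g u != g v by rewrite (inj_eq g_inj).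
have d2 : d u v = 2%N by rewrite dE tail_dist_clip // guv eqxx.
have not_adj : ~~ G u v.
  have [[gu gv]|[gu gv]] : (g u = m.+2 /\ g v = m.+3) \/ (g u = m.+3 /\ g v = m.+2).
  - by have := g_lt u; have := g_lt v; move/eqP: guv'; lia.
  - by rewrite -(gK u) -(gK v) gu gv.
  - by rewrite -(gK u) -(gK v) gu gv adj_sym.
have := le_d u v; rewrite d2; have := dist_eq0 G_conn u v; have := dist_eq1 G_conn u v.
by rewrite (negPf uv) (negPf not_adj); lia.
Qed.

Lemma rho_L_max_isomorphic (G : sgraph V) : connected G -> #|pendants G| = 3%N ->
  rho <= rho_L R G -> isomorphic G T.
Proof.
move=> G_conn pend3 rho_le.
have [[x x0 x_eig] _ _ _ _] := rho_L_spec R G_conn isT.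
have G_hull := dist_hull G_conn pend3 cardV m_gt0.
have d_sym : dist G =2 (fun u v => dist G v u) by move=> u v; exact: dist_sym.
have GE := eigfun_energy d_sym x_eig.
have [leE eqE] := hull_energy x0 G_hull.
have sumsq_ge0 : 0 <= sumsq x by apply: sumr_ge0 => u _; exact: sqr_ge0.
(* The hull gives the upper bound; [rho_le] and the eigenvalue equation of [G] give the lower
   one. *)
have E : energy (dist G) x = 2 * rho * sumsq x.
  have scale (a b s : R) : a <= b -> 0 <= s -> 2 * a * s <= 2 * b * s.
    by move=> ab s_ge0; rewrite -!mulrA ler_pM2l // ler_wpM2r.
  apply/le_anti/andP; split; [exact: leE|rewrite GE].
  exact: (scale _ _ _ rho_le sumsq_ge0).
have [le_d [g [y [gd xE y_decr]]]] := eqE E.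
apply: (@labelled_T312 _ g) => //; apply: (labelled_rigid G_conn pend3 gd le_d) => u v ne.
(* Labels that differ after clipping carry different values, by strict monotonicity. *)
have xuv : x u != x v.
  case: gd => _ g_lt _; rewrite xE /=; apply: contra_neqN ne => yuv.
  have ltF z : tail_decr m z -> z (g u) = z (g v) -> minn (g u) m.+2 = minn (g v) m.+2.
    move=> z_decr zuv; have := tail_decr_lt z_decr (g_lt u) (g_lt v).
    by have := tail_decr_lt z_decr (g_lt v) (g_lt u); rewrite zuv ltxx; lia.
  by case: y_decr => /ltF; apply; rewrite (eqP yuv).
have gE : energy (order_dist x) x = 2 * rho * sumsq x.
  apply/le_anti/andP; split.
    have [|] := tail_metric_top m_gt0 x (d := order_dist x); last by [].
    case: gd => g_inj g_lt dE; exists g; split=> // a b.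
    by rewrite dE tail_dist_comb.
  rewrite -E; apply: ler_sum => a _; apply: ler_sum => b _.
  by rewrite ler_wpM2r ?sqr_ge0 // ler_nat.
have diff_ge0 a b : 0 <= ((order_dist x a b)%:R - (dist G a b)%:R) * (x a - x b) ^+ 2.
  by rewrite mulr_ge0 ?sqr_ge0 // subr_ge0 ler_nat.
(* A vanishing sum of nonnegative terms makes the two metrics agree wherever [x] takes different
   values. *)
have : \sum_a \sum_b ((order_dist x a b)%:R - (dist G a b)%:R) * (x a - x b) ^+ 2 == 0.
  rewrite (eq_bigr (fun a => \sum_b (order_dist x a b)%:R * (x a - x b) ^+ 2
      - \sum_b (dist G a b)%:R * (x a - x b) ^+ 2)); last first.
    by move=> a _; rewrite -sumrB; apply: eq_bigr => b _; rewrite mulrBl.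
  by rewrite sumrB subr_eq0; apply/eqP; rewrite -[LHS]/(energy _ _) gE -E.
rewrite psumr_eq0; last by move=> a _; apply: sumr_ge0.
move=> /allP/(_ u (mem_index_enum _)); rewrite /= psumr_eq0 //.
move=> /allP/(_ v (mem_index_enum _)) /=.
by rewrite mulf_eq0 sqrf_eq0 !subr_eq0 (negPf xuv) orbF eqr_nat => /eqP.
Qed.

End Main.

Theorem theorem2p7 (R : realType) (n : nat) (n_ge5 : (5 <= n)%N)
    (G : sgraph 'I_n) (G_connected : connected G) (G_pendants : #|pendants G| = 3%N)
    (G_max : forall G' : sgraph 'I_n,
       connected G' -> #|pendants G'| = 3%N -> rho_L R G' <= rho_L R G) :
  isomorphic G (T312 n).
Proof.
case: n n_ge5 G G_connected G_pendants G_max => [|[|[|[|m]]]] // m_ge5 G G_conn pend3 G_max.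
(* The tree itself is one of the competitors of [G]. *)
have le_rho := G_max _ (T312_dist m).1 (T312_pendants m).
have m_gt0 : (0 < m)%N by [].
exact: (rho_L_max_isomorphic m_gt0 G_conn pend3 le_rho).
Qed.
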